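(* Let $G_m$ be a bounded Vilenkin group, let $t_n$ be the Nörlund means generated by a non-increasing sequence $\{q_k:k\in\mathbb{N}\}$ (of nonnegative numbers with $q_0>0$ and $Q_n\to\infty$) satisfying $$\frac{1}{Q_n}=O\left(\frac1n\right)\quad\text{as } n\to\infty,$$ and let $1\le p<\infty$. Then there is a constant $C>0$, independent of $n$, $N$ and $f$, such that for every $f\in L^p(G_m)$, every $N\in\mathbb{N}$ and every $n$ with $M_N\le n<M_{N+1}$, $$\Vert t_nf-f\Vert_p\le C\sum_{j=0}^{N}\frac{M_j}{M_N}\,\omega_p\left(\frac{1}{M_j},f\right).$$
   Context: $\mathbb{N}_+$ is the set of positive integers and $\mathbb{N}=\mathbb{N}_+\cup\{0\}$. Let $m=(m_0,m_1,\dots)$ be a sequence of integers $\ge 2$ with $\sup_k m_k<\infty$ (bounded case). $Z_{m_k}=\{0,1,\dots,m_k-1\}$ is the additive group of integers modulo $m_k$, and $G_m=\prod_{k\ge0}Z_{m_k}$ is the complete direct product with the product of the discrete topologies; elements are $x=(x_0,x_1,\dots)$ with $x_k\in Z_{m_k}$. The Haar measure $\mu$ on $G_m$, with $\mu(G_m)=1$, is the product of the uniform measures $\mu_k(\{j\})=1/m_k$. Put $M_0=1$, $M_{k+1}=m_kM_k$. Every $n\in\mathbb{N}$ is uniquely $n=\sum_{j\ge0}n_jM_j$ with $n_j\in Z_{m_j}$, only finitely many nonzero. Generalized Rademacher functions: $r_k(x)=\exp(2\pi i x_k/m_k)$. Vilenkin system: $\psi_n(x)=\prod_{k\ge0}r_k(x)^{n_k}$,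 $n\in\mathbb{N}$. For $f\in L^1(G_m)$: $\widehat f(k)=\int_{G_m}f\,\overline{\psi_k}\,d\mu$, $S_nf=\sum_{k=0}^{n-1}\widehat f(k)\psi_k$ ($n\in\mathbb{N}_+$), $S_0f=0$. $\Vert f\Vert_p=(\int_{G_m}|f|^p\,d\mu)^{1/p}$. Nörlund means: for a sequence $\{q_k:k\ge0\}$ of nonnegative numbers with $q_0>0$, put $Q_n=\sum_{k=0}^{n-1}q_k$ and assume $\lim_{n\to\infty}Q_n=\infty$; then $t_nf=\frac{1}{Q_n}\sum_{k=1}^{n}q_{n-k}S_kf$ for $n\in\mathbb{N}_+$. Modulus of continuity: $\omega_p(\delta,f)=\sup_{|t|<\delta}\Vert f(\cdot+t)-f(\cdot)\Vert_p$ for $\delta>0$, where $+$ is the group operation of $G_m$ and $|t|=\sum_{k\ge0}t_k/M_{k+1}$ for $t=(t_0,t_1,\dots)\in G_m$. *)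

(* Defs.v *)
From HB Require Import structures.
From mathcomp Require Import all_boot all_order all_algebra.
From mathcomp Require Import all_classical all_reals all_analysis.
From mathcomp Require Import measurable_realfun complex.
Set Implicit Arguments.
Unset Strict Implicit.
Unset Printing Implicit Defensive.
Import Order.TTheory GRing.Theory Num.Theory.
Import numFieldNormedType.Exports.
Local Open Scope classical_set_scope.
Local Open Scope complex_scope.
Local Open Scope ring_scope.

Section VilenkinGroup.
Variable m : nat -> nat.

Definition Mprod (n : nat) : nat := (\prod_(k < n) m k)%N.

Definition digit (n j : nat) : nat := ((n %/ Mprod j) %% m j)%N.

(* For 2 <= m k the type 'Z_(m k) has exactly m k elements. *)
Definition coordinates : Type := forall k : nat, 'Z_(m k).

HB.instance Definition _ := gen_eqMixin coordinates.
HB.instance Definition _ := gen_choiceMixin coordinates.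
HB.instance Definition _ := isPointed.Build coordinates (fun=> 0).

Definition cylinder (n : nat) (a : coordinates) : set coordinates :=
  [set x | forall k, (k < n)%N -> x k = a k].

(* The discrete sigma-algebras on the countably many factors have as product
   the sigma-algebra generated by the one-coordinate sets, which is also the
   Borel sigma-algebra of the product topology. *)
Definition coordinate_sets : set (set coordinates) :=
  [set A | exists k (j : 'Z_(m k)), A = [set x | x k = j]].

Definition vilenkin := g_sigma_algebraType coordinate_sets.

Definition vadd (x t : vilenkin) : vilenkin := fun k => x k + t k.

End VilenkinGroup.

Section VilenkinAnalysis.
Variables (R : realType) (m : nat -> nat).
Local Notation G := (vilenkin m).

(* The product of the uniform measures; cylinders together with set0 form a
   generating pi-system, so at most one probability satisfies this; one exists
   by product_of_uniform_exists. *)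
Definition is_product_of_uniform (mu : probability G R) : Prop :=
  forall (n : nat) (a : G),
    mu (cylinder n a) = (\prod_(k < n) (m k)%:R^-1)%:E.

Definition vabs (t : G) : \bar R :=
  (\sum_(0 <= k <oo) ((t k : nat)%:R / (Mprod m k.+1)%:R)%:E)%E.

Definition expi (u : R) : R[i] := cos u +i* sin u.

Definition rademacher (k : nat) (x : G) : R[i] :=
  expi (2 * pi * (x k : nat)%:R / (m k)%:R).

(* The factors with k >= n are trivial, see digit_eq0. *)
Definition psi (n : nat) (x : G) : R[i] :=
  \prod_(k < n) rademacher k x ^+ digit m n k.

Variable mu : probability G R.

Definition cintegral (f : G -> R[i]) : R[i] :=
  (\int[mu]_x complex.Re (f x)) +i* (\int[mu]_x complex.Im (f x)).

Definition cLnorm (p : R) (f : G -> R[i]) : \bar R :=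
  Lnorm mu p%:E (fun x => (ComplexField.Normc.normc (f x))%:E).

Definition in_Lp (p : R) (f : G -> R[i]) : Prop :=
  [/\ measurable_fun setT (fun x => complex.Re (f x)),
      measurable_fun setT (fun x => complex.Im (f x)) &
      (cLnorm p f < +oo)%E].

Definition fourier_coef (f : G -> R[i]) (k : nat) : R[i] :=
  cintegral (fun x => f x * (psi k x)^*).

Definition partial_sum (n : nat) (f : G -> R[i]) (x : G) : R[i] :=
  \sum_(k < n) fourier_coef f k * psi k x.

Definition Qsum (q : nat -> R) (n : nat) : R := \sum_(k < n) q k.

Definition norlund (q : nat -> R) (n : nat) (f : G -> R[i]) (x : G) : R[i] :=
  ((Qsum q n)^-1)%:C *
  \sum_(1 <= k < n.+1) (q (n - k)%N)%:C * partial_sum k f x.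

Definition modulus (p : R) (delta : R) (f : G -> R[i]) : \bar R :=
  ereal_sup [set cLnorm p (fun x => f (vadd x t) - f x) |
             t in [set t : G | (vabs t < delta%:E)%E]].

End VilenkinAnalysis.

Section DigitFacts.
Variable m : nat -> nat.
Hypothesis hm : forall k, (2 <= m k)%N.

Lemma MprodS n : Mprod m n.+1 = (Mprod m n * m n)%N.
Proof. by rewrite /Mprod big_ord_recr. Qed.

Lemma ltn_Mprod n : (n < Mprod m n)%N.
Proof.
elim: n => [|n IHn]; first by rewrite /Mprod big_ord0.
rewrite MprodS (@leq_trans (Mprod m n * 2)) ?leq_mul2l ?hm ?orbT//.
rewrite muln2 -addnn (@leq_trans (n.+1 + n.+1)) ?leq_add//.
by rewrite addnS ltnS leq_addr.
Qed.

Lemma digit_expansion_mod n K :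
  (\sum_(j < K) digit m n j * Mprod m j = n %% Mprod m K)%N.
Proof.
elim: K => [|K IHK]; first by rewrite /Mprod !big_ord0 modn1.
rewrite big_ord_recr/= IHK MprodS /digit.
have M0 : (0 < Mprod m K)%N := leq_ltn_trans (leq0n _) (ltn_Mprod K).
have m0 : (0 < m K)%N by apply: leq_trans (hm K).
have := ltn_pmod (n %/ Mprod m K) m0; have := ltn_pmod n M0.
have := divn_eq (n %/ Mprod m K) (m K); have := divn_eq n (Mprod m K).
set a := (n %% Mprod m K)%N; set b := (_ %% m K)%N => E2 E1 ha hb; rewrite E2 E1.
rewrite mulnDl -mulnA (mulnC (m K)) -addnA modnMDl modn_small; first exact: addnC.
rewrite (leq_trans (n := b * Mprod m K + Mprod m K))// ?ltn_add2l//.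
by rewrite addnC -mulSn mulnC leq_mul2l hb orbT.
Qed.

Lemma digit_expansion n K : (n < Mprod m K)%N ->
  n = (\sum_(j < K) digit m n j * Mprod m j)%N.
Proof. by move=> nK; rewrite digit_expansion_mod modn_small. Qed.

Lemma digit_eq0 n j : (n <= j)%N -> digit m n j = 0%N.
Proof.
by move=> nj; rewrite /digit divn_small ?mod0n// (leq_ltn_trans nj)// ltn_Mprod.
Qed.

End DigitFacts.

(* The product measure is realized as the image of Lebesgue measure on [0, 1[
   under the mixed-radix digit expansion. *)
Section ProductMeasureExists.
Variables (R : realType) (m : nat -> nat).
Hypothesis hm : forall k, (2 <= m k)%N.

Let M_gt0 n : (0 < Mprod m n)%N.
Proof. exact: leq_ltn_trans (leq0n _) (ltn_Mprod hm n). Qed.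

Let phi (x : R) : vilenkin m :=
  fun k => inZp (Num.truncn (x * (Mprod m k.+1)%:R)).

Let measurable_phi : measurable_fun setT phi.
Proof.
refine (@measurability _ _ _ (vilenkin m) _ _ (@coordinate_sets m) _ _) => //.
move=> _ [_ [k [j ->]]] <-; rewrite setTI.
have -> : phi @^-1` [set x | x k = j] =
    \bigcup_(N in [set N | inZp N = j])
      ([set x : R | (Num.truncn (x * (Mprod m k.+1)%:R) = N)]).
  by apply/seteqP; split => [x/= <-|x/= [N/= <- <-]]//; eexists; last reflexivity.
apply: bigcup_measurable => N _.
have -> : [set x : R | Num.truncn (x * (Mprod m k.+1)%:R) = N] =
    (fun x => x * (Mprod m k.+1)%:R) @^-1`
       (`]-oo, N.+1%:R[ `&` [set y : R | (N <= Num.truncn y)%N]).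
  apply/seteqP; split => x/=; rewrite in_itv/= -truncn_le_nat.
    by move=> ->.
  by move=> [xN Nx]; apply/eqP; rewrite eqn_leq xN Nx.
have mf : measurable_fun setT (fun x : R => x * (Mprod m k.+1)%:R).
  exact: mulrr_measurable.
rewrite -[X in measurable X]setTI; apply: mf => //.
apply: measurableI => //.
case: N => [|N]; first by rewrite (_ : mkset _ = setT)//; apply/seteqP.
rewrite (_ : mkset _ = `[N.+1%:R, +oo[%classic)//.
by apply/seteqP; split => y/=; rewrite in_itv/= andbT truncn_gt_nat.
Qed.

Let unit_itv_measurable : measurable (`[0, 1[%classic : set R).
Proof. exact: measurable_itv. Qed.

Definition digit_measure : set (vilenkin m) -> \bar R :=
  pushforward (mrestr (@lebesgue_measure R) unit_itv_measurable) phi.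

Let digit_measure0 : digit_measure set0 = 0%E.
Proof. exact: measure0. Qed.

Let digit_measure_ge0 A : (0 <= digit_measure A)%E.
Proof. exact: measure_ge0. Qed.

Let digit_measure_sigma_additive : semi_sigma_additive digit_measure.
Proof. exact: measure_semi_sigma_additive. Qed.

HB.instance Definition _ := isMeasure.Build _ _ _ digit_measure
  digit_measure0 digit_measure_ge0 digit_measure_sigma_additive.

Let digit_measure1 : digit_measure setT = 1%E.
Proof.
rewrite /digit_measure/= /pushforward preimage_setT /mrestr setTI.
by rewrite lebesgue_measure_itv/= lte_fin ltr01 oppr0 adde0.
Qed.

HB.instance Definition _ := Measure_isProbability.Build _ _ _
  digit_measure digit_measure1.

Let preimage_cylinder n (a : vilenkin m) : exists2 A : nat, (A < Mprod m n)%N &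
  forall x : R, 0 <= x -> x < 1 ->
    cylinder n a (phi x) <-> Num.truncn (x * (Mprod m n)%:R) = A.
Proof.
elim: n => [|n [A AM IHA]].
  exists 0%N; first by rewrite /Mprod big_ord0.
  move=> x x0 x1; split=> // _; apply/eqP; rewrite /Mprod big_ord0 mulr1.
  by rewrite -leqn0 truncn_le_nat.
have mn0 : (0 < m n)%N := ltnW (hm n).
have am : (a n < m n)%N by rewrite (leq_trans (ltn_ord (a n)))// Zp_cast.
have truncM (x : R) : 0 <= x ->
    Num.truncn (x * (Mprod m n)%:R) =
    (Num.truncn (x * (Mprod m n.+1)%:R) %/ m n)%N.
  move=> x0; set y := x * _; have y0 : 0 <= y by rewrite mulr_ge0.
  have -> : x * (Mprod m n.+1)%:R = y * (m n)%:R by rewrite MprodS natrM mulrA.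
  set T := Num.truncn (y * _).
  apply: truncn_def.
  have /andP[T1 T2] : T%:R <= y * (m n)%:R < T.+1%:R.
    by apply: truncn_itv; rewrite mulr_ge0.
  have m0 : 0 < (m n)%:R :> R by rewrite ltr0n.
  rewrite -(ler_pM2r m0) -(ltr_pM2r m0) -!natrM.
  rewrite (le_trans _ T1) ?ler_nat ?leq_divM// (lt_le_trans T2)// ler_nat.
  by rewrite -ltn_divLR.
have phiE (x : R) : (phi x n : nat) = (Num.truncn (x * (Mprod m n.+1)%:R) %% m n)%N.
  by rewrite /phi/= Zp_cast.
exists (A * m n + a n)%N.
  rewrite MprodS (@leq_trans (A * m n + m n))// ?ltn_add2l//.
  by rewrite addnC -mulSn leq_mul2r AM orbT.
move=> x x0 x1; have IH := IHA x x0 x1; split.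
  move=> cx; rewrite (divn_eq (Num.truncn _) (m n)) -truncM// -phiE.
  rewrite (cx n)//; congr (_ * _ + _)%N; apply/IH => k kn.
  by apply: cx; exact: ltnW.
move=> xA k; rewrite ltnS leq_eqVlt => /predU1P[->|kn].
  by apply/ord_inj; rewrite phiE xA modnMDl modn_small.
have /IH : Num.truncn (x * (Mprod m n)%:R) = A.
  by rewrite truncM// xA divnMDl// divn_small ?addn0.
exact.
Qed.

Lemma product_of_uniform_exists :
  exists mu : probability (vilenkin m) R, is_product_of_uniform mu.
Proof.
exists digit_measure => n a.
have [A AM cylE] := preimage_cylinder n a.
have M0 : 0 < (Mprod m n)%:R :> R by rewrite ltr0n.
have phi_cyl : phi @^-1` cylinder n a `&` `[0, 1[%classic =
    `[A%:R / (Mprod m n)%:R, A.+1%:R / (Mprod m n)%:R[%classic.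
  apply/seteqP; split => x/=.
    rewrite in_itv/= => -[cx /andP[x0 x1]]; have /cylE := cx => /(_ x0 x1) xA.
    rewrite in_itv/= ler_pdivrMr// ltr_pdivlMr// -xA truncn_itv//.
    by rewrite mulr_ge0.
  rewrite in_itv/= ler_pdivrMr// ltr_pdivlMr// => AxA.
  have /andP[Ax xA] := AxA.
  have x0 : 0 <= x by rewrite -(pmulr_lge0 _ M0) (le_trans _ Ax).
  have x1 : x < 1.
    by rewrite -(ltr_pM2r M0) mul1r (lt_le_trans xA)// ler_nat.
  split; last by rewrite in_itv/= x0 x1.
  by apply/cylE => //; exact: truncn_def.
rewrite -[LHS]/(@lebesgue_measure R (phi @^-1` cylinder n a `&` `[0, 1[%classic)).
rewrite phi_cyl lebesgue_measure_itv/= lte_fin ltr_pM2r ?invr_gt0// ltr_nat ltnSn.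
rewrite -EFinB -mulrBl -natrB// subSnn mul1r; congr (_%:E).
by rewrite prodfV -natr_prod.
Qed.

End ProductMeasureExists.

(* Main.v *)
(* Let D_k be the Dirichlet kernels and F_n = D_0 + ... + D_(n-1). Abel summation, with
   q non-increasing and 1/Q_n = O(1/n), reduces the theorem to the Fejer case: the operator
   with kernel F_n, applied to t |-> f(x+t) - f(x), must have L^p norm at most a constant
   times sum_(j<=N) M_j omega_p(1/M_j, f) for n <= M_(N+1).
   For 0 < a < m_A and l <= M_A,
     F_(a M_A + l) = F_(a M_A) + l D_(a M_A) + r_A^a F_l.
   The kernel D_(a M_A) is supported on I_A and is bounded by a M_A. The kernel F_l does not
   depend on the digit t_A while r_A^a has mean zero in it, so r_A^a F_l only sees
   increments of f by shifts of size < 1/M_A. This cancellation is what avoids the factor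
   N - j + 1 that estimates of |F_n| alone would produce. Both terms contribute
   O(M_A omega_p(1/M_A, f)) by Minkowski's integral inequality, because ||F_l||_1 = O(M_A).
   The last bound follows from the same recursion, since sum_(b<m_A) r_A^b is m_A times the
   indicator of t_A = 0, which is independent of F_(M_A). *)
Require Import Defs.
From mathcomp Require Import all_boot all_order all_algebra.
From mathcomp Require Import all_classical all_reals all_analysis.
From mathcomp Require Import complex.
From mathcomp Require Import measurable_realfun ring lra.
Set Implicit Arguments.
Unset Strict Implicit.
Unset Printing Implicit Defensive.
Import Order.TTheory GRing.Theory Num.Theory.
Import numFieldNormedType.Exports.
Local Open Scope classical_set_scope.
Local Open Scope ring_scope.

(** The digit t_A is never isolated by writing [mu] as a product. Its independence of the other
    digits is always used as invariance under the translations by s e_A ([vunit]), followed by a sum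
    over the m_A values of s. Translation invariance itself comes from the cylinder formula by
    uniqueness of measures. The term r_A^a F_l of the recursion is estimated in one stroke for every
    l <= M_A, not by recursing into F_l. Only F_(a M_A) is reduced further, down to F_(M_A) and then
    to the next lower level. So level A is charged a < m_A <= B times with a multiple of M_A
    omega_p(1/M_A, f), and the levels add up to the sum over j. Since F_0 = F_1 = 0, the induction
    starts at M_0 = 1 without error. In the Abel summation the coefficients are q_0 and the
    differences of q. Monotonicity bounds the sum of their absolute values by 2 q_0, which leaves
    the factor 2 q_0 / Q_n = O(1/M_N). *)

Section WeightedJensen.
Context d (T : measurableType d) (R : realType).
Variable mu : {measure set T -> \bar R}.
Local Open Scope ereal_scope.

(** Hölder's inequality for the splitting k h = k^(1/q) (k^(1/p) h), which retains only the total
    mass of the weight k. The case p = 1 is separate because the conjugate exponent q = p / (p - 1)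
    degenerates. *)
Lemma weighted_jensen (k h : T -> R) (p c : R) :
  measurable_fun setT k -> measurable_fun setT h ->
  (forall x, 0 <= k x)%R -> (forall x, 0 <= h x)%R -> (1 <= p)%R ->
  \int[mu]_x (k x)%:E <= c%:E ->
  (\int[mu]_x (k x * h x)%:E) `^ p <=
  (c `^ (p - 1))%:E * \int[mu]_x (k x * h x `^ p)%:E.
Proof.
move=> mk mh k0 h0; rewrite le_eqVlt => /predU1P[<- _|p1 kc].
  rewrite subrr powRr0 mul1e poweRe1; last first.
    by apply: integral_ge0 => x _; rewrite lee_fin mulr_ge0.
  by under [leRHS]eq_integral do rewrite powRr1//.
have p0 : (0 < p)%R by rewrite (lt_trans _ p1).
have p10 : (0 < p - 1)%R by rewrite subr_gt0.
pose q := (p / (p - 1))%R.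
have q0 : (0 < q)%R by rewrite divr_gt0.
have qV : (q^-1 = 1 - p^-1)%R by rewrite /q invf_div mulrBl mul1r divff ?gt_eqF.
have pq : (p^-1 + q^-1 = 1)%R by rewrite qV addrC subrK.
pose f x := (k x `^ q^-1)%R; pose g x := (k x `^ p^-1 * h x)%R.
have mf : measurable_fun setT f by exact: (measurableT_comp (measurable_powR _)).
have mg : measurable_fun setT g.
  by apply: measurable_funM => //; exact: (measurableT_comp (measurable_powR _)).
have := hoelder mu mg mf p0 q0 pq.
rewrite Lnorm1.
under eq_integral => x _.
  rewrite /= /f /g mulrAC -powRD ?pq ?oner_eq0// powRr1// ger0_norm ?mulr_ge0//.
  over.
move=> kh.
have Nf : 'N[mu]_q%:E[EFin \o f] `^ p <= (c `^ (p - 1))%:E.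
  (* Writing the outer exponent as q (p - 1) turns the q-norm of f into (int f^q)^(p - 1), and f^q =
     k. *)
  have -> : p = (q * (p - 1))%R by rewrite /q mulfVK ?gt_eqF.
  rewrite poweRrM powR_Lnorm ?gt_eqF//.
  have -> : (q * (p - 1) - 1 = p - 1)%R by rewrite /q mulfVK ?gt_eqF.
  have E : \int[mu]_x (`|(EFin \o f) x| `^ q) = \int[mu]_x (k x)%:E.
    apply: eq_integral => x _.
    by rewrite /= ger0_norm ?powR_ge0// /f -powRrM mulVf ?gt_eqF// powRr1.
  have k1 : 0 <= \int[mu]_x (k x)%:E by apply: integral_ge0 => x _; rewrite lee_fin.
  rewrite E -poweR_EFin; apply: gt0_ler_poweR (kc); first exact: ltW.
    by rewrite in_itv/= leey andbT.
  by rewrite in_itv/= leey andbT (le_trans _ kc).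
have Ng : 'N[mu]_p%:E[EFin \o g] `^ p = \int[mu]_x (k x * h x `^ p)%:E.
  rewrite powR_Lnorm ?gt_eqF//; apply: eq_integral => x _.
  rewrite /= ger0_norm ?mulr_ge0 ?powR_ge0// /g powRM ?powR_ge0//.
  by rewrite -powRrM mulVf ?gt_eqF// powRr1.
apply: (@le_trans _ _ (('N[mu]_p%:E[EFin \o g] * 'N[mu]_q%:E[EFin \o f]) `^ p)).
  rewrite gt0_ler_poweR ?(ltW p0)// in_itv/= leey andbT.
    by apply: integral_ge0 => x _; rewrite lee_fin mulr_ge0.
  by rewrite mule_ge0 ?Lnorm_ge0.
rewrite poweRM ?Lnorm_ge0// Ng muleC lee_wpmul2r//.
by apply: integral_ge0 => x _; rewrite lee_fin mulr_ge0 ?powR_ge0.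
Qed.

End WeightedJensen.

(** * Minkowski's integral inequality with a weight *)

Section MinkowskiIntegral.
Context d1 d2 (T1 : measurableType d1) (T2 : measurableType d2) (R : realType).
Variables (mu1 : {sigma_finite_measure set T1 -> \bar R})
  (mu2 : {sigma_finite_measure set T2 -> \bar R}).
Local Open Scope ereal_scope.

(** Jensen in y at each fixed x, then Tonelli: the factor c^(p - 1) from Jensen and the remaining
    mass c of k combine to c^p. The bound w is required only where k is nonzero, so that the support
    of a kernel can be exploited. *)
Lemma minkowski_integral (k : T2 -> R) (H : T1 * T2 -> R) (p c : R) (w : \bar R) :
  measurable_fun setT k -> measurable_fun setT H ->
  (forall y, 0 <= k y)%R -> (forall z, 0 <= H z)%R ->
  (1 <= p)%R -> (0 < c)%R -> 0 <= w ->
  \int[mu2]_y (k y)%:E <= c%:E ->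
  (forall y, k y != 0%R -> Lnorm mu1 p%:E (fun x => (H (x, y))%:E) <= w) ->
  Lnorm mu1 p%:E (fun x => \int[mu2]_y (k y * H (x, y))%:E) <= c%:E * w.
Proof.
move=> mk mH k0 H0 p1 c0 w0 kc Hw.
have p0 : (0 < p)%R by rewrite (lt_le_trans _ p1).
have [->|wfin] := eqVneq w +oo; first by rewrite gt0_muley ?lte_fin// leey.
have [r wE r0] : exists2 r : R, w = r%:E & (0 <= r)%R.
  by case: w w0 wfin {Hw} => // r r0 _; exists r; rewrite -?lee_fin.
rewrite wE in Hw *.
have mHy y : measurable_fun setT (fun x => H (x, y)).
  exact: (measurableT_comp mH (pair2_measurable y)).
have mHx x : measurable_fun setT (fun y => H (x, y)).
  exact: (measurableT_comp mH (pair1_measurable x)).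
have mk2 : measurable_fun setT (fun z : T1 * T2 => k z.2).
  exact: measurableT_comp.
have mHp : measurable_fun setT (fun z : T1 * T2 => H z `^ p)%R.
  exact: (measurableT_comp (measurable_powR _)).
pose F (z : T1 * T2) := (k z.2 * H z `^ p)%:E.
have mF : measurable_fun setT F.
  by apply/measurable_EFinP; exact: measurable_funM.
have F0 z : 0 <= F z by rewrite lee_fin mulr_ge0 ?powR_ge0.
pose J x := \int[mu2]_y (k y * H (x, y))%:E.
have J0 x : 0 <= J x by apply: integral_ge0 => y _; rewrite lee_fin mulr_ge0.
have mJ : measurable_fun setT J.
  apply: (@measurable_fun_fubini_tonelli_F _ _ _ _ _ mu2
    (fun z : T1 * T2 => (k z.2 * H z)%:E)).
    by apply/measurable_EFinP; exact: measurable_funM.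
  by move=> z; rewrite lee_fin mulr_ge0.
have int_le : \int[mu1]_x (J x `^ p) <= ((c * r) `^ p)%:E.
  apply: (@le_trans _ _ (\int[mu1]_x
      ((c `^ (p - 1))%:E * \int[mu2]_y F (x, y)))).
    apply: ge0_le_integral => //.
    - by move=> x _; exact: poweR_ge0.
    - exact: (measurableT_comp (measurable_poweR _)).
    - by apply: emeasurable_funM => //; exact: measurable_fun_fubini_tonelli_F.
    - by move=> x _; exact: weighted_jensen.
  rewrite ge0_integralZl//; last 3 first.
  - exact: measurable_fun_fubini_tonelli_F.
  - by move=> x _; exact: integral_ge0.
  - by rewrite lee_fin powR_ge0.
  rewrite fubini_tonelli//.
  apply: (@le_trans _ _ ((c `^ (p - 1))%:E *
      \int[mu2]_y ((k y)%:E * (r `^ p)%:E))).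
    rewrite lee_wpmul2l ?lee_fin ?powR_ge0//.
    apply: ge0_le_integral => //.
    - by move=> y _; exact: integral_ge0.
    - exact: measurable_fun_fubini_tonelli_G.
    - by apply: emeasurable_funM => //; exact/measurable_EFinP.
    move=> y _.
    under eq_integral do rewrite /F/= EFinM.
    rewrite ge0_integralZl//; last 3 first.
    - by apply/measurable_EFinP; exact: (measurableT_comp (measurable_powR _)).
    - by move=> x _; rewrite lee_fin powR_ge0.
    - by rewrite lee_fin.
    have [->|ky0] := eqVneq (k y) 0%R; first by rewrite !mul0e.
    rewrite lee_wpmul2l ?lee_fin//.
    have /gt0_ler_poweR := Hw y ky0 => /(_ p (ltW p0)).
    rewrite !in_itv/= !leey !andbT lee_fin Lnorm_ge0 r0 => /(_ isT isT).
    rewrite powR_Lnorm ?gt_eqF//=; apply: le_trans.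
    rewrite le_eqVlt; apply/orP; left; apply/eqP.
    by apply: eq_integral => x _; rewrite /= ger0_norm.
  rewrite ge0_integralZr//; last 3 first.
  - exact/measurable_EFinP.
  - by move=> y _; rewrite lee_fin.
  - by rewrite lee_fin powR_ge0.
  rewrite muleA powRM ?(ltW c0)// EFinM lee_wpmul2r ?lee_fin ?powR_ge0//.
  rewrite -(mulr_powRB1 (ltW c0) p0) mulrC EFinM.
  by rewrite lee_wpmul2l ?lee_fin ?powR_ge0.
rewrite unlock /Lnorm -EFinM.
have -> : (c * r)%:E = ((c * r) `^ p)%:E `^ p^-1.
  by rewrite poweR_EFin -powRrM mulfV ?gt_eqF// powRr1// mulr_ge0// ltW.
have absJ x : `|J x| = J x by rewrite gee0_abs.
apply: gt0_ler_poweR => //.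
- by rewrite invr_ge0 ltW.
- by rewrite in_itv/= leey andbT; apply: integral_ge0 => x _; exact: poweR_ge0.
- by rewrite in_itv/= leey andbT lee_fin powR_ge0.
- by under eq_integral do rewrite absJ.
Qed.

End MinkowskiIntegral.

(** * Measurability on the group and translation invariance of the measure *)

Section TranslationInvariance.
Variables (R : realType) (m : nat -> nat).
Local Notation G := (vilenkin m).

Lemma measurable_coordinate k (P : set 'Z_(m k)) :
  measurable [set x : G | P (x k)].
Proof.
have -> : [set x : G | P (x k)] = \bigcup_(j in P) [set x : G | x k = j].
  by apply/seteqP; split => [x Px|x [j Pj /= ->]]; [exists (x k)|].
apply: fin_bigcup_measurable => [|j _]; first exact: finite_finset.
by apply: sub_sigma_algebra; exists k, j.
Qed.

Lemma measurable_fun_coordinate d (T : measurableType d) k (g : 'Z_(m k) -> T) :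
  measurable_fun setT (fun x : G => g (x k)).
Proof. by move=> _ A mA; rewrite setTI; exact: (measurable_coordinate (g @^-1` A)). Qed.

Lemma measurable_cylinder n (a : G) : measurable (cylinder n a : set G).
Proof.
have -> : (cylinder n a : set G) = \bigcap_(k in [set k | (k < n)%N]) [set x : G | x k = a k].
  by apply/seteqP; split.
by apply: bigcap_measurableType => k _; exact: (measurable_coordinate [set a k]).
Qed.

Lemma measurable_vadd : measurable_fun setT (fun z : G * G => vadd z.1 z.2).
Proof.
refine (@measurability _ _ _ (vilenkin m) _ _ (@coordinate_sets m) _ _) => //.
move=> _ [_ [k [j ->]]] <-; rewrite setTI.
have -> : (fun z : G * G => vadd z.1 z.2) @^-1` [set x | x k = j] =
    \bigcup_i ([set x : G | x k = i] `*` [set x : G | x k = j - i]).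
  apply/seteqP; split => [[x y]/= <-|[x y] [i _ [/= xi yj]]].
    by exists (x k) => //; split => //=; rewrite /vadd addrAC subrr add0r.
  by rewrite /vadd xi yj addrC subrK.
apply: fin_bigcup_measurable => [|i _]; first exact: finite_finset.
apply: measurableX; first exact: (measurable_coordinate [set i]).
exact: (measurable_coordinate [set j - i]).
Qed.

Lemma measurable_vaddr (x : G) : measurable_fun setT (vadd x).
Proof. exact: (measurableT_comp measurable_vadd (pair1_measurable x)). Qed.

Lemma vaddC : commutative (@vadd m).
Proof. by move=> x y; apply: functional_extensionality_dep => k; rewrite /vadd addrC. Qed.

Lemma vaddA : associative (@vadd m).
Proof. by move=> x y z; apply: functional_extensionality_dep => k; rewrite /vadd addrA. Qed.

Variable mu : probability G R.
Hypothesis hmu : is_product_of_uniform mu.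

Lemma cylinders_generate :
  @measurable _ G = <<s [set A | A = set0 \/ exists n a, A = @cylinder m n a] >>.
Proof.
set C := [set A | _].
have CG : C `<=` @measurable _ G.
  by move=> _ [->|[n [a ->]]] //; exact: measurable_cylinder.
apply/seteqP; split; last first.
  exact: smallest_sub (sigma_algebra_measurable G) CG.
apply: smallest_sub; first exact: smallest_sigma_algebra.
move=> _ [k [j ->]].
(* Cylinders are indexed by finite prefixes instead of points of G: there are countably many
   prefixes, so the union below becomes a sequence through [unpickle]. *)
pose a (s : seq nat) : G := fun i => inZp (nth 0%N s i).
have -> : [set x : G | x k = j] =
    \bigcup_(s in [set s | a s k = j]) cylinder k.+1 (a s).
  apply/seteqP; split => [x/= <-|x [s /= <-]]; last by apply.
  exists (mkseq (fun i => x i : nat) k.+1).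
    by rewrite /mkset /a nth_mkseq// valZpK.
  by move=> i ik; rewrite /a nth_mkseq// valZpK.
have -> : \bigcup_(s in [set s | a s k = j]) cylinder k.+1 (a s) =
   \bigcup_i (if unpickle i is Some s then
     if a s k == j then cylinder k.+1 (a s) else set0 else set0).
  apply/seteqP; split => [x [s /= sj xs]|x [i _]].
    have [i si] : exists i, unpickle i = Some s by exists (pickle s); exact: pickleK.
    by exists i => //; case: si => ->; rewrite sj eqxx.
  case: (unpickle i) => // s; case: ifPn => // /eqP sj xs.
  by exists s.
apply: sigma_algebra_bigcup => i; case: ifP => _; last exact: sigma_algebra0.
by apply: sub_sigma_algebra; right; do 2 eexists.
Qed.

(** Two finite measures agreeing on a generating pi-system coincide, and the preimage of a cylinder
    under a translation is a cylinder of the same length, hence of the same mass. *)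
Lemma vadd_preserves_measure (x : G) (A : set G) :
  measurable A -> pushforward mu (vadd x) A = mu A.
Proof.
pose mu' : {measure set G -> \bar R} := pushforward mu (vadd x).
pose C := [set A | A = set0 \/ exists n a, A = @cylinder m n a].
pose mu'' := (mu : {measure set G -> \bar R}).
have := @measure_unique _ R G C (fun=> setT) cylinders_generate _ _ _
  (mu' (measurable_vaddr x)) mu''.
apply.
- move=> _ _ [->|[n [a ->]]] [->|[n' [b ->]]]; rewrite ?set0I ?setI0; [by left..|].
  (* Two cylinders are disjoint or share a point c; in the latter case they meet in the cylinder
     around c of the larger length. *)
  have [[c [ca cb]]|noc] := pselect (exists c, cylinder n a c /\ cylinder n' b c).
    right; exists (maxn n n'), c; apply/seteqP; split => y.
      move=> [ya yb] k; rewrite leq_max => /orP[kn|kn].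
        by rewrite ya// ca.
      by rewrite yb// cb.
    move=> yc; split=> k kn; rewrite yc ?leq_max ?kn ?orbT//.
      by rewrite ca.
    by rewrite cb.
  by left; apply/seteqP; split => // y [ya yb]; apply: noc; exists y.
- move=> _; right; exists 0%N, (fun=> 0); apply/seteqP; split => //.
- by apply/seteqP; split => // y _; exists 0%N.
- move=> _ [->|[n [a ->]]]; first by rewrite !measure0.
  rewrite /mu'/= /pushforward.
  have -> : vadd x @^-1` cylinder n a = cylinder n (fun k => a k - x k).
    apply/seteqP; split => y /= ya k kn.
      by rewrite -ya// /vadd addrAC subrr add0r.
    by rewrite /vadd ya// addrC subrK.
  by rewrite /mu'' !hmu.
- move=> k /=; rewrite /pushforward preimage_setT.
  by rewrite (le_lt_trans (probability_le1 _ _))// ltry.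
Qed.

Lemma ge0_integral_vadd (x : G) (f : G -> \bar R) :
  measurable_fun setT f -> (forall t, 0 <= f t)%E ->
  (\int[mu]_t f (vadd x t) = \int[mu]_t f t)%E.
Proof.
move=> mf f0.
rewrite -[LHS]/(\int[mu]_(t in vadd x @^-1` setT) (f \o vadd x) t)%E.
rewrite -(ge0_integral_pushforward (measurable_vaddr x))//.
apply: eq_measure_integral; first exact: measurable_vaddr.
by move=> mx A mA _; exact: vadd_preserves_measure.
Qed.

End TranslationInvariance.

(** * Modulus of complex numbers and roots of unity *)

Section ComplexNorm.
Variable R : realType.
Local Notation normc := ComplexField.Normc.normc.

Lemma normc_ge0 (z : R[i]) : 0 <= normc z.
Proof. by case: z => a b; exact: sqrtr_ge0. Qed.

Lemma normcD (z w : R[i]) : normc (z + w) <= normc z + normc w.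
Proof. exact: le_normcD. Qed.

Lemma normc_sum (I : Type) (s : seq I) (P : pred I) (F : I -> R[i]) :
  normc (\sum_(i <- s | P i) F i) <= \sum_(i <- s | P i) normc (F i).
Proof.
elim/big_rec2: _ => [|i y z _ IH]; first by rewrite ComplexField.Normc.normc0.
by rewrite (le_trans (normcD _ _))// lerD2l.
Qed.

Lemma normcX (z : R[i]) n : normc (z ^+ n) = normc z ^+ n.
Proof.
elim: n => [|n IH]; first by rewrite !expr0 ComplexField.Normc.normc1.
by rewrite !exprS ComplexField.Normc.normcM IH.
Qed.

Lemma normc_prod (I : Type) (s : seq I) (P : pred I) (F : I -> R[i]) :
  normc (\prod_(i <- s | P i) F i) = \prod_(i <- s | P i) normc (F i).
Proof.
elim/big_rec2: _ => [|i y z _ <-]; first by rewrite ComplexField.Normc.normc1.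
by rewrite ComplexField.Normc.normcM.
Qed.

Lemma normc_real (a : R) : normc (a%:C%C) = `|a|.
Proof. by rewrite /= expr0n addr0 sqrtr_sqr. Qed.

Lemma normc_nat (n : nat) : normc (n%:R : R[i]) = n%:R.
Proof. by rewrite -(rmorph_nat (real_complex R)) normc_real normr_nat. Qed.

Lemma conjCE (z : R[i]) : z^* = conjc z.
Proof. by []. Qed.

Lemma normc_conj (z : R[i]) : normc z^* = normc z.
Proof. by case: z => a b; rewrite conjCE /= sqrrN. Qed.

Lemma Re_le_normc (z : R[i]) : `|complex.Re z| <= normc z.
Proof.
case: z => a b /=; rewrite -sqrtr_sqr ler_wsqrtr// lerDl.
exact: sqr_ge0.
Qed.

Lemma Im_le_normc (z : R[i]) : `|complex.Im z| <= normc z.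
Proof.
case: z => a b /=; rewrite -sqrtr_sqr ler_wsqrtr// lerDr.
exact: sqr_ge0.
Qed.

Lemma normc_expi (u : R) : normc (expi u) = 1.
Proof. by rewrite /= cos2Dsin2 sqrtr1. Qed.

Lemma expiD (u v : R) : expi (u + v) = expi u * expi v.
Proof. by rewrite /expi cosD sinD; congr Complex => //; rewrite addrC mulrC. Qed.

Lemma expi0 : expi 0 = 1 :> R[i].
Proof. by rewrite /expi cos0 sin0. Qed.

Lemma expiMn (u : R) n : expi (u *+ n) = expi u ^+ n.
Proof.
elim: n => [|n IH]; first by rewrite mulr0n expi0 expr0.
by rewrite mulrS expiD IH exprS.
Qed.

Lemma expi_2pi : expi (2 * pi) = 1 :> R[i].
Proof.
by rewrite /expi mulr_natl cos2pi sin2pi.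
Qed.

(** The real part is 1 - 2 sin(u/2)^2, and the sine is positive at u/2, which lies strictly between
    0 and pi. *)
Lemma expi_neq1 (u : R) : 0 < u < 2 * pi -> expi u != 1.
Proof.
move=> /andP[u0 u2]; apply/eqP => -[cu1 _].
have : sin (u / 2) != 0 by rewrite gt_eqF// sin_gt0_pi//; apply/andP; split; lra.
have : cos u = 1 - sin (u / 2) ^+ 2 *+ 2.
  have -> : u = u / 2 + u / 2 by lra.
  rewrite cosD; have -> : (u / 2 + u / 2) / 2 = u / 2 by lra.
  have := cos2Dsin2 (u / 2); rewrite -!expr2 mulr2n; lra.
rewrite cu1 => /eqP; rewrite -subr_eq0 opprB addrC subrK mulrn_eq0/= sqrf_eq0.
by move=> /eqP ->; rewrite eqxx.
Qed.

(** The exponent is a natural number, not a residue, so that exponents can be added and multiplied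
    before [root_unity_mod] reduces them. *)
Definition root_unity (M n : nat) : R[i] := expi (2 * pi * n%:R / M%:R).

Lemma root_unityD M a b : root_unity M (a + b) = root_unity M a * root_unity M b.
Proof. by rewrite /root_unity natrD -expiD; congr expi; rewrite mulrDr mulrDl. Qed.

Lemma root_unityM M a b : root_unity M (a * b) = root_unity M a ^+ b.
Proof. by rewrite /root_unity -expiMn natrM; congr expi; rewrite -[RHS]mulr_natr; ring. Qed.

Lemma root_unity_full M : (0 < M)%N -> root_unity M M = 1.
Proof. by move=> M0; rewrite /root_unity mulfK ?expi_2pi// pnatr_eq0 -lt0n. Qed.

Lemma root_unity_mod M n : (0 < M)%N -> root_unity M (n %% M) = root_unity M n.
Proof.
move=> M0; rewrite [in RHS](divn_eq n M) root_unityD mulnC root_unityM.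
by rewrite root_unity_full// expr1n mul1r.
Qed.

Lemma root_unity_neq1 M n : (0 < n < M)%N -> root_unity M n != 1.
Proof.
move=> /andP[n0 nM]; have M0 : (0 < M%:R :> R) by rewrite ltr0n (leq_trans _ nM).
have pi2 : 0 < 2 * pi :> R by rewrite mulr_gt0// pi_gt0.
apply: expi_neq1; apply/andP; split; first by rewrite divr_gt0// mulr_gt0// ltr0n.
by rewrite ltr_pdivrMr// ltr_pM2l// ltr_nat.
Qed.

(** A geometric sum: multiplied by z - 1 it becomes z^M - 1 = 0. *)
Lemma sum_root_unity M n : (0 < M)%N -> root_unity M n != 1 ->
  \sum_(b < M) root_unity M n ^+ b = 0.
Proof.
move=> M0 z1; have z0 : root_unity M n - 1 != 0 by rewrite subr_eq0.
apply: (mulfI z0).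
by rewrite mulr0 -subrX1 -root_unityM mulnC root_unityM root_unity_full// expr1n subrr.
Qed.

End ComplexNorm.

(** * Characters, Dirichlet kernels and their sums: algebraic identities *)

Section Characters.
Variables (R : realType) (m : nat -> nat).
Hypothesis hm : forall k, (2 <= m k)%N.
Local Notation G := (vilenkin m).
Local Notation normc := ComplexField.Normc.normc.

Let m_gt0 k : (0 < m k)%N. Proof. exact: ltnW. Qed.

Lemma Mprod_gt0 n : (0 < Mprod m n)%N.
Proof. exact: leq_ltn_trans (leq0n _) (ltn_Mprod hm n). Qed.

Lemma leq_Mprod n l : (n <= l)%N -> (Mprod m n <= Mprod m l)%N.
Proof.
move=> nl; rewrite -(subnK nl); elim: (l - n)%N => // k IH.
by rewrite addSn MprodS (leq_trans IH)// leq_pmulr.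
Qed.

Lemma digit_block A b l : (b < m A)%N -> (l < Mprod m A)%N ->
  forall j, digit m (b * Mprod m A + l) j =
    if (j < A)%N then digit m l j else if j == A then b else 0%N.
Proof.
move=> bA lA j; rewrite /digit; case: ltngtP => [jA|Aj|->].
(* For j < A, M_(j+1) divides M_A; after division by M_j the summand b M_A is therefore a multiple
   of m_j and does not affect digit j. *)
- have [c cE] : exists c, Mprod m A = (c * m j * Mprod m j)%N.
    have := jA; elim: A {bA lA jA} => // A IH.
    rewrite ltnS leq_eqVlt => /predU1P[->|/IH[c E]].
      by exists 1%N; rewrite mul1n MprodS mulnC.
    by exists (c * m A)%N; rewrite MprodS E; ring.
  rewrite cE mulnA divnMDl ?Mprod_gt0//.
  by rewrite (_ : (b * (c * m j) = b * c * m j)%N) ?modnMDl// mulnA.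
- rewrite divn_small ?mod0n//.
  apply: (@leq_trans (Mprod m A.+1)); last exact: leq_Mprod.
  rewrite MprodS (mulnC (Mprod m A)) (@leq_trans (b * Mprod m A + Mprod m A))// ?ltn_add2l//.
  by rewrite addnC -mulSn leq_mul2r bA orbT.
- by rewrite divnMDl ?Mprod_gt0// (divn_small lA) addn0 modn_small.
Qed.

Lemma rademacherE k (x : G) : rademacher R k x = root_unity R (m k) (x k).
Proof. by []. Qed.

Lemma rademacher_vadd k (x t : G) :
  rademacher R k (vadd x t) = rademacher R k x * rademacher R k t.
Proof.
rewrite !rademacherE -root_unityD -[RHS]root_unity_mod//.
by rewrite /vadd /= [X in (_ %% X)%N]Zp_cast.
Qed.

Lemma normc_rademacher k (x : G) : normc (rademacher R k x) = 1.
Proof. exact: normc_expi. Qed.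

(** The product defining [psi] has a range depending on the index; a common range K makes characters
    of different indices comparable factor by factor. *)
Lemma psi_widen K n (x : G) : (n <= K)%N ->
  psi R n x = \prod_(k < K) rademacher R k x ^+ digit m n k.
Proof.
move=> nK; rewrite /psi -!(big_mkord xpredT (fun k => rademacher R k x ^+ digit m n k)).
rewrite [RHS](big_cat_nat (leq0n n) nK)//= [X in _ = _ * X]big_nat_cond.
rewrite [X in _ = _ * X]big1 ?mulr1// => k /andP[/andP[nk _] _].
by rewrite digit_eq0.
Qed.

Lemma psi0 (x : G) : psi R 0 x = 1.
Proof. by rewrite /psi big_ord0. Qed.

Lemma psi_vadd n (x t : G) : psi R n (vadd x t) = psi R n x * psi R n t.
Proof.
rewrite /psi -big_split/=; apply: eq_bigr => k _.
by rewrite rademacher_vadd exprMn.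
Qed.

Lemma normc_psi n (x : G) : normc (psi R n x) = 1.
Proof.
rewrite /psi normc_prod big1// => k _.
by rewrite normcX normc_rademacher expr1n.
Qed.

Lemma psi_block A b l (x : G) : (b < m A)%N -> (l < Mprod m A)%N ->
  psi R (b * Mprod m A + l) x = rademacher R A x ^+ b * psi R l x.
Proof.
move=> bA lA; pose K := (maxn A.+1 (b * Mprod m A + l))%N.
have AK : (A < K)%N by rewrite leq_maxl.
have lK : (l <= K)%N by rewrite leq_max leq_addl orbT.
rewrite (@psi_widen K) ?leq_maxr// (psi_widen _ lK).
rewrite (bigD1 (Ordinal AK))//= [in RHS](bigD1 (Ordinal AK))//=.
rewrite digit_block// ltnn eqxx.
have dl j : (A <= j)%N -> digit m l j = 0%N.
  by move=> Aj; rewrite /digit divn_small ?mod0n// (leq_trans lA)// leq_Mprod.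
rewrite (dl A)// expr0 mul1r; congr (_ * _); apply: eq_bigr => j jA.
rewrite digit_block//; case: ifP => // /negbT; rewrite -leqNgt => Aj.
by rewrite ifF ?dl//; apply: contraNF jA => /eqP jE; exact/eqP/val_inj.
Qed.

(** The element s e_A. Translating by it changes digit A alone, which is how that digit gets
    averaged. *)
Definition vunit A (s : nat) : G := fun k => if k == A then inZp s else 0.

Lemma rademacher_vunit k A s :
  rademacher R k (vunit A s) = if k == A then root_unity R (m A) s else 1.
Proof.
rewrite rademacherE /vunit; case: eqP => [->|_]; last first.
  by rewrite /root_unity/= mulr0 mul0r expi0.
by rewrite /= [X in (_ %% X)%N]Zp_cast// root_unity_mod.
Qed.

Lemma psi_vunit n A s :
  psi R n (vunit A s) = root_unity R (m A) s ^+ digit m n A.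
Proof.
pose K := maxn A.+1 n; have AK : (A < K)%N by rewrite leq_maxl.
rewrite (@psi_widen K) ?leq_maxr// (bigD1 (Ordinal AK))//= rademacher_vunit eqxx.
rewrite big1 ?mulr1// => k kA; rewrite rademacher_vunit ifF ?expr1n//.
by apply: contraNF kA => /eqP kE; exact/eqP/val_inj.
Qed.

Lemma sum_rademacher A (t : G) :
  \sum_(b < m A) rademacher R A t ^+ b = if t A == 0 then (m A)%:R else 0.
Proof.
case: eqP => [tA|/eqP tA].
  rewrite rademacherE tA /root_unity/= mulr0 mul0r expi0.
  by under eq_bigr do rewrite expr1n; rewrite sumr_const card_ord.
apply: sum_root_unity => //; apply: root_unity_neq1; apply/andP; split.
  by rewrite lt0n; apply: contraNneq tA => tA; exact/eqP/val_inj.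
by rewrite (leq_trans (ltn_ord (t A)))// Zp_cast.
Qed.

Definition dirichlet n (t : G) : R[i] := \sum_(i < n) psi R i t.

Lemma dirichletD A b l t : (b < m A)%N -> (l <= Mprod m A)%N ->
  dirichlet (b * Mprod m A + l) t =
  dirichlet (b * Mprod m A) t + rademacher R A t ^+ b * dirichlet l t.
Proof.
move=> bA lA; rewrite /dirichlet big_split_ord/= mulr_sumr; congr (_ + _).
apply: eq_bigr => i _; apply: psi_block => //.
exact: leq_trans (ltn_ord i) lA.
Qed.

Lemma dirichletM A b t : (b <= m A)%N ->
  dirichlet (b * Mprod m A) t =
  (\sum_(c < b) rademacher R A t ^+ c) * dirichlet (Mprod m A) t.
Proof.
elim: b => [|b IH] bA; first by rewrite mul0n /dirichlet !big_ord0 mul0r.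
by rewrite mulSn addnC dirichletD// IH ?(ltnW bA)// big_ord_recr/= mulrDl.
Qed.

(** By [dirichletM] with b = m_A, passing from A to A + 1 multiplies the kernel by the full sum of
    powers of r_A, that is, by m_A times the indicator of t_A = 0. *)
Lemma dirichlet_Mprod A t : dirichlet (Mprod m A) t =
  if `[< forall k, (k < A)%N -> t k = 0 >] then (Mprod m A)%:R else 0.
Proof.
elim: A => [|A IH].
  by rewrite asboolT// /Mprod big_ord0 /dirichlet big_ord1 psi0.
rewrite MprodS (mulnC (Mprod m A)) dirichletM// IH sum_rademacher natrM.
have -> : `[< forall k, (k < A.+1)%N -> t k = 0 >] =
    (t A == 0) && `[< forall k, (k < A)%N -> t k = 0 >].
  apply/asboolP/andP => [tA|[/eqP tA /asboolP tk] k].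
    by split; [exact/eqP/tA|apply/asboolP => k kA; exact/tA/ltnW].
  by rewrite ltnS leq_eqVlt => /predU1P[->//|]; exact: tk.
by case: (t A == 0) => /=; [case: ifP; rewrite ?mulr0|rewrite mul0r].
Qed.

(** All indices below M_A have digit 0 at position A, so their characters ignore t_A. *)
Lemma dirichlet_vunit A s l t : (l <= Mprod m A)%N ->
  dirichlet l (vadd t (vunit A s)) = dirichlet l t.
Proof.
move=> lA; apply: eq_bigr => i _; rewrite psi_vadd psi_vunit /digit.
by rewrite divn_small ?mod0n ?expr0 ?mulr1// (leq_trans (ltn_ord i)).
Qed.

(** For n >= 2 this is n - 1 times the Fejér kernel (D_1 + ... + D_(n-1)) / (n - 1). Without the
    division the recursion has no denominators. *)
Definition dirichlet_sum n (t : G) : R[i] := \sum_(k < n) dirichlet k t.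

Lemma dirichlet_sumD A a l t : (a < m A)%N -> (l <= Mprod m A)%N ->
  dirichlet_sum (a * Mprod m A + l) t = dirichlet_sum (a * Mprod m A) t +
    (l%:R * dirichlet (a * Mprod m A) t + rademacher R A t ^+ a * dirichlet_sum l t).
Proof.
move=> aA lA; rewrite /dirichlet_sum big_split_ord/=; congr (_ + _).
under eq_bigr => i _ do rewrite dirichletD ?(leq_trans (ltnW (ltn_ord i)))//.
by rewrite big_split/= sumr_const card_ord mulr_natl mulr_sumr.
Qed.

Lemma dirichlet_sum_vunit A s l t : (l <= Mprod m A)%N ->
  dirichlet_sum l (vadd t (vunit A s)) = dirichlet_sum l t.
Proof.
move=> lA; apply: eq_bigr => i _; apply: dirichlet_vunit.
by rewrite (leq_trans (ltnW (ltn_ord i))).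
Qed.

(** Obtained by adding a full block l = M_A to each of the a multiples b M_A in [dirichlet_sumD]. *)
Lemma dirichlet_sum_Mprod_mul A a t : (a <= m A)%N ->
  dirichlet_sum (a * Mprod m A) t =
  \sum_(b < a) ((Mprod m A)%:R * dirichlet (b * Mprod m A) t) +
  (\sum_(b < a) rademacher R A t ^+ b) * dirichlet_sum (Mprod m A) t.
Proof.
elim: a => [|a IH] aA; first by rewrite mul0n /dirichlet_sum !big_ord0 mul0r addr0.
rewrite mulSn addnC dirichlet_sumD// IH ?(ltnW aA)// !big_ord_recr/=.
by rewrite mulrDl addrACA.
Qed.

End Characters.

(** * Measurability and the L^1 norm of complex functions *)

Section ComplexMeasurable.
Context d (T : measurableType d) (R : realType).
Local Notation normc := ComplexField.Normc.normc.

Definition cmeasurable (g : T -> R[i]) :=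
  measurable_fun setT (fun x => complex.Re (g x)) /\
  measurable_fun setT (fun x => complex.Im (g x)).

Lemma cmeasurable_cst (c : R[i]) : cmeasurable (fun=> c).
Proof. by split; exact: measurable_cst. Qed.

Lemma cmeasurableD (g h : T -> R[i]) :
  cmeasurable g -> cmeasurable h -> cmeasurable (fun x => g x + h x).
Proof.
move=> [g1 g2] [h1 h2]; split.
  rewrite (_ : (fun _ => _) = fun x => complex.Re (g x) + complex.Re (h x)).
    exact: measurable_funD.
  by apply/funext => x; case: (g x) => ? ?; case: (h x).
rewrite (_ : (fun _ => _) = fun x => complex.Im (g x) + complex.Im (h x)).
  exact: measurable_funD.
by apply/funext => x; case: (g x) => ? ?; case: (h x).
Qed.

Lemma cmeasurableM (g h : T -> R[i]) :
  cmeasurable g -> cmeasurable h -> cmeasurable (fun x => g x * h x).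
Proof.
move=> [g1 g2] [h1 h2]; split.
  rewrite (_ : (fun _ => _) = fun x => complex.Re (g x) * complex.Re (h x) -
      complex.Im (g x) * complex.Im (h x)).
    by apply: measurable_funB; exact: measurable_funM.
  by apply/funext => x; case: (g x) => ? ?; case: (h x).
rewrite (_ : (fun _ => _) = fun x => complex.Re (g x) * complex.Im (h x) +
    complex.Im (g x) * complex.Re (h x)).
  by apply: measurable_funD; exact: measurable_funM.
by apply/funext => x; case: (g x) => ? ?; case: (h x).
Qed.

Lemma cmeasurable_conj (g : T -> R[i]) :
  cmeasurable g -> cmeasurable (fun x => (g x)^*).
Proof.
move=> [g1 g2]; split.
  by rewrite (_ : (fun _ => _) = fun x => complex.Re (g x))//; apply/funext => x; case: (g x).
rewrite (_ : (fun _ => _) = fun x => - complex.Im (g x)).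
  exact: measurableT_comp.
by apply/funext => x; case: (g x).
Qed.

Lemma cmeasurableB (g h : T -> R[i]) :
  cmeasurable g -> cmeasurable h -> cmeasurable (fun x => g x - h x).
Proof.
move=> mg mh; rewrite (_ : (fun _ => _) = fun x => g x + (-1) * h x).
  by apply: cmeasurableD => //; apply: cmeasurableM => //; exact: cmeasurable_cst.
by apply/funext => x; rewrite mulN1r.
Qed.

Lemma cmeasurable_sum (I : Type) (s : seq I) (F : I -> T -> R[i]) :
  (forall i, cmeasurable (F i)) -> cmeasurable (fun x => \sum_(i <- s) F i x).
Proof.
move=> mF; elim: s => [|i s IH].
  by under eq_fun do rewrite big_nil; exact: cmeasurable_cst.
by under eq_fun do rewrite big_cons; exact: cmeasurableD.
Qed.

Lemma cmeasurable_prod (I : Type) (s : seq I) (F : I -> T -> R[i]) :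
  (forall i, cmeasurable (F i)) -> cmeasurable (fun x => \prod_(i <- s) F i x).
Proof.
move=> mF; elim: s => [|i s IH].
  by under eq_fun do rewrite big_nil; exact: cmeasurable_cst.
by under eq_fun do rewrite big_cons; exact: cmeasurableM.
Qed.

Lemma cmeasurableX (g : T -> R[i]) n :
  cmeasurable g -> cmeasurable (fun x => g x ^+ n).
Proof.
move=> mg; elim: n => [|n IH]; first by under eq_fun do rewrite expr0; exact: cmeasurable_cst.
by under eq_fun do rewrite exprS; exact: cmeasurableM.
Qed.

Lemma measurable_normc (g : T -> R[i]) :
  cmeasurable g -> measurable_fun setT (fun x => normc (g x)).
Proof.
move=> [g1 g2]; rewrite (_ : (fun _ => _) =
  fun x => Num.sqrt (complex.Re (g x) ^+ 2 + complex.Im (g x) ^+ 2)).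
  apply: (measurableT_comp (continuous_measurable_fun (@sqrt_continuous R))).
  by apply: measurable_funD; exact: measurable_funX.
by apply/funext => x; case: (g x).
Qed.

Lemma measurable_normc_EFin (g : T -> R[i]) :
  cmeasurable g -> measurable_fun setT (fun x => (normc (g x))%:E).
Proof. by move=> mg; apply/measurable_EFinP; exact: measurable_normc. Qed.

Variable mu : {measure set T -> \bar R}.
Local Open Scope ereal_scope.

Definition L1norm (g : T -> R[i]) : \bar R := \int[mu]_x (normc (g x))%:E.

Lemma L1norm_ge0 g : 0 <= L1norm g.
Proof. by apply: integral_ge0 => x _; rewrite lee_fin normc_ge0. Qed.

Lemma le_L1norm (g : T -> R[i]) (h : T -> R) : cmeasurable g ->
  measurable_fun setT h -> (forall x, normc (g x) <= h x)%R ->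
  L1norm g <= \int[mu]_x (h x)%:E.
Proof.
move=> mg mh gh; apply: ge0_le_integral => //.
- by move=> x _; rewrite lee_fin normc_ge0.
- exact: measurable_normc_EFin.
- exact/measurable_EFinP.
- by move=> x _; rewrite lee_fin.
Qed.

Lemma L1normD g h : cmeasurable g -> cmeasurable h ->
  L1norm (fun x => g x + h x)%R <= L1norm g + L1norm h.
Proof.
move=> mg mh; rewrite /L1norm -ge0_integralD//=; last 4 first.
- by move=> x _; rewrite lee_fin normc_ge0.
- exact: measurable_normc_EFin.
- by move=> x _; rewrite lee_fin normc_ge0.
- exact: measurable_normc_EFin.
apply: le_L1norm; first exact: cmeasurableD.
  by apply: measurable_funD; exact: measurable_normc.
by move=> x; exact: normcD.
Qed.

Lemma L1normM (c g : T -> R[i]) (k : R) : cmeasurable c -> cmeasurable g ->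
  (forall x, normc (c x) <= k)%R -> L1norm (fun x => c x * g x)%R <= k%:E * L1norm g.
Proof.
move=> mc mg ck.
have k0 : (0 <= k)%R by rewrite (le_trans (normc_ge0 _) (ck point)).
rewrite /L1norm -ge0_integralZl//; last 2 first.
- exact: measurable_normc_EFin.
- by move=> x _; rewrite lee_fin normc_ge0.
apply: le_L1norm; first exact: cmeasurableM.
  by apply: measurable_funM => //; exact: measurable_normc.
by move=> x; rewrite ComplexField.Normc.normcM ler_wpM2r ?normc_ge0.
Qed.

Lemma L1norm_sum (I : Type) (s : seq I) (F : I -> T -> R[i]) :
  (forall i, cmeasurable (F i)) ->
  L1norm (fun x => \sum_(i <- s) F i x)%R <= \sum_(i <- s) L1norm (F i).
Proof.
move=> mF; elim: s => [|i s IH].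
  rewrite big_nil /L1norm; under eq_integral do rewrite big_nil ComplexField.Normc.normc0.
  by rewrite integral0.
rewrite big_cons; under [X in L1norm X]eq_fun do rewrite big_cons.
by rewrite (le_trans (L1normD _ _))// ?leeD2l//; exact: cmeasurable_sum.
Qed.

End ComplexMeasurable.
Arguments cmeasurable_cst {d T R} c.

(** * L^1 bounds for Dirichlet kernels and averaging over one digit *)

Section KernelBounds.
Variables (R : realType) (m : nat -> nat).
Hypothesis hm : forall k, (2 <= m k)%N.
Local Notation G := (vilenkin m).
Local Notation normc := ComplexField.Normc.normc.
Variable mu : probability G R.
Hypothesis hmu : is_product_of_uniform mu.
Local Notation L1 := (L1norm mu).

Let m_gt0 k : (0 < m k)%N. Proof. exact: ltnW. Qed.

Lemma cmeasurable_rademacher k : cmeasurable (rademacher R k : G -> R[i]).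
Proof.
have mk (g : 'Z_(m k) -> R) := @measurable_fun_coordinate m _ _ k g.
split.
  exact: (mk (fun j => cos (2 * pi * (j : nat)%:R / (m k)%:R))).
exact: (mk (fun j => sin (2 * pi * (j : nat)%:R / (m k)%:R))).
Qed.

Lemma cmeasurable_psi n : cmeasurable (psi R n : G -> R[i]).
Proof. by apply: cmeasurable_prod => k; apply: cmeasurableX; exact: cmeasurable_rademacher. Qed.

Lemma cmeasurable_dirichlet n : cmeasurable (dirichlet R n : G -> R[i]).
Proof. by apply: cmeasurable_sum => k; exact: cmeasurable_psi. Qed.

Lemma cmeasurable_dirichlet_sum n : cmeasurable (dirichlet_sum R n : G -> R[i]).
Proof. by apply: cmeasurable_sum => k; exact: cmeasurable_dirichlet. Qed.

Lemma cmeasurable_sum_rademacher A b :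
  cmeasurable (fun t : G => \sum_(c < b) rademacher R A t ^+ c).
Proof. by apply: cmeasurable_sum => c; apply: cmeasurableX; exact: cmeasurable_rademacher. Qed.

Lemma normc_sum_rademacher A b (t : G) : normc (\sum_(c < b) rademacher R A t ^+ c) <= b%:R.
Proof.
rewrite (le_trans (normc_sum _ _ _))// -[b in leRHS]card_ord -sumr_const ler_sum// => c _.
by rewrite normcX normc_rademacher expr1n.
Qed.

Lemma integral_dirichlet_Mprod A : L1 (dirichlet R (Mprod m A)) = 1%E.
Proof.
have M0 : ((Mprod m A)%:R != 0 :> R) by rewrite pnatr_eq0 -lt0n Mprod_gt0.
pose C : set G := cylinder A (fun=> 0).
have mC : measurable C by exact: measurable_cylinder.
transitivity (\int[mu]_t ((Mprod m A)%:R * \1_C t)%:E)%E.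
  apply: eq_integral => t _; rewrite dirichlet_Mprod//.
  rewrite indicE /C; case: asboolP => [tA|tA].
    by rewrite mem_set// mulr1 normc_nat.
  by rewrite memNset// mulr0 ComplexField.Normc.normc0.
under eq_integral do rewrite EFinM.
rewrite ge0_integralZl//; last exact/measurable_EFinP/measurable_indic.
rewrite integral_indic// setIT.
rewrite [X in (_ * X)%E](_ : _ = (\prod_(k < A) (m k)%:R^-1)%:E); last exact: hmu.
by rewrite -EFinM prodfV -natr_prod mulfV.
Qed.

Lemma L1_dirichlet_mul A b : (b <= m A)%N -> (L1 (dirichlet R (b * Mprod m A)) <= b%:R%:E)%E.
Proof.
move=> bA; rewrite (_ : dirichlet R _ =
  fun t => (\sum_(c < b) rademacher R A t ^+ c) * dirichlet R (Mprod m A) t); last first.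
  by apply/funext => t; rewrite dirichletM.
rewrite (le_trans (L1normM _ _ _ (@normc_sum_rademacher A b)))//.
- exact: cmeasurable_sum_rademacher.
- exact: cmeasurable_dirichlet.
- by rewrite integral_dirichlet_Mprod mule1.
Qed.

(** Independence of the digit t_A from a function g that ignores it. For h = 1_(t_A = 0) g, the m_A
    translates of h by s e_A add up to g, and all of them have the same integral. *)
Lemma integral_coordinate_eq0 A (g : G -> R) :
  measurable_fun setT g -> (forall t, 0 <= g t) ->
  (forall s t, g (vadd t (vunit m A s)) = g t) ->
  (\int[mu]_t ((if t A == 0%R then (m A)%:R else 0%R) * g t)%:E =
   \int[mu]_t (g t)%:E)%E.
Proof.
move=> mg g0 gA.
pose h (t : G) := (if t A == 0 then 1 else 0) * g t.
have h0 t : 0 <= h t by rewrite mulr_ge0//; case: ifP.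
have mh : measurable_fun setT h.
  apply: measurable_funM => //.
  exact: (measurable_fun_coordinate (fun j : 'Z_(m A) => (if j == 0 then 1 else 0 : R))).
have mhs s : measurable_fun setT (fun t => h (vadd t (vunit m A s))).
  apply: (measurableT_comp mh).
  exact: (measurableT_comp (@measurable_vadd m) (pair2_measurable _)).
transitivity (\int[mu]_t ((m A)%:R * h t)%:E)%E.
  by apply: eq_integral => t _; rewrite /h mulrA; case: ifP; rewrite ?mulr1 ?mulr0.
transitivity (\int[mu]_t
    (\sum_(s <- index_enum 'I_(m A)) (h (vadd t (vunit m A s)))%:E))%E; last first.
  apply: eq_integral => t _; rewrite sumEFin; congr EFin.
  (* Exactly one translate is nonzero at t: the one whose s represents - t A. *)
  have tA : (val (- t A) < m A)%N by rewrite (leq_trans (ltn_ord _))// Zp_cast.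
  have vunitE s : (s < m A)%N -> val (vunit m A s A) = s.
    by move=> sA; rewrite /vunit eqxx /= modn_small// Zp_cast.
  rewrite (bigD1 (Ordinal tA))//= big1 ?addr0 => [|s sA].
    rewrite /h gA /vadd (_ : vunit m A _ A = - t A) ?subrr ?eqxx ?mul1r//.
    by apply/val_inj; rewrite vunitE.
  rewrite /h ifF ?mul0r//; apply: contraNF sA; rewrite /vadd addrC addr_eq0 => /eqP tAs.
  by apply/eqP/val_inj; rewrite -[LHS](vunitE s)// tAs.
rewrite ge0_integral_sum//; last 2 first.
- by move=> s; exact/measurable_EFinP.
- by move=> s t _; rewrite lee_fin.
transitivity (\sum_(s <- index_enum 'I_(m A)) \int[mu]_t (h t)%:E)%E; last first.
  apply: eq_bigr => s _.
  rewrite -(ge0_integral_vadd hmu (vunit m A s))//; last exact/measurable_EFinP.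
  by apply: eq_integral => t _; rewrite vaddC.
under eq_integral do rewrite EFinM.
rewrite ge0_integralZl//; last 2 first.
- exact/measurable_EFinP.
- by move=> t _; rewrite lee_fin.
(* The integral of h may be infinite; then both m_A times it and the sum of m_A copies of it are
   +oo. *)
have := @integral_ge0 _ _ _ mu setT (EFin \o h) (fun t _ => h0 t).
case: (\int[mu]_t (h t)%:E)%E => [r| |]// _.
  by rewrite sumEFin sumr_const card_ord -EFinM mulr_natl.
rewrite gt0_muley ?lte_fin ?ltr0n//.
rewrite (bigD1 (Ordinal (m_gt0 A)))//= addye// gt_eqF//.
by rewrite (@lt_le_trans _ _ 0%E)// sume_ge0.
Qed.

End KernelBounds.

(** * L^1 bounds for sums of Dirichlet kernels *)

Section FejerKernelBounds.
Variables (R : realType) (m : nat -> nat).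
Hypothesis hm : forall k, (2 <= m k)%N.
Local Notation G := (vilenkin m).
Local Notation normc := ComplexField.Normc.normc.
Variable mu : probability G R.
Hypothesis hmu : is_product_of_uniform mu.
Local Notation L1 := (L1norm mu).
Variable B : nat.
Hypothesis hB : forall k, (m k <= B)%N.

Let m_gt0 k : (0 < m k)%N. Proof. exact: ltnW. Qed.

Lemma L1_sum_dirichlet A a : (a <= m A)%N ->
  (L1 (fun t => \sum_(b < a) ((Mprod m A)%:R * dirichlet R (b * Mprod m A) t))%R <=
   (B * B * Mprod m A)%:R%:E)%E.
Proof.
move=> aA.
have mMD b : cmeasurable (fun t : G => (Mprod m A)%:R * dirichlet R (b * Mprod m A) t).
  by apply: cmeasurableM; [exact: cmeasurable_cst|exact: cmeasurable_dirichlet].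
apply: (le_trans (L1norm_sum mu _ (fun b : 'I_a => mMD b))).
apply: (@le_trans _ _ (\sum_(b < a) (B * Mprod m A)%:R%:E)%E).
  apply: lee_sum => b _.
  have nM (x : G) : normc ((Mprod m A)%:R : R[i]) <= (Mprod m A)%:R by rewrite normc_nat.
  apply: (le_trans (L1normM mu (cmeasurable_cst _) (@cmeasurable_dirichlet R m _) nM)).
  have bA : (b <= m A)%N by rewrite (leq_trans (ltnW (ltn_ord b))).
  rewrite (mulnC B) natrM EFinM lee_wpmul2l//.
  rewrite (le_trans (L1_dirichlet_mul hm hmu bA))// lee_fin ler_nat.
  exact: leq_trans (hB A).
rewrite sumEFin sumr_const card_ord lee_fin -mulrnA ler_nat mulnAC.
by rewrite leq_mul2r leq_mul2l (leq_trans aA (hB A)) !orbT.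
Qed.

(** By independence the norm of F_(M_A) enters the step with coefficient 1, although its multiplier
    takes the value m_A. The step therefore produces B^2 M_A + B^2 M_A, which is at most B^2 M_(A+1)
    because m_A >= 2. *)
Lemma L1_dirichlet_sum_Mprod A :
  (L1 (dirichlet_sum R (Mprod m A)) <= (B * B * Mprod m A)%:R%:E)%E.
Proof.
have cF n : cmeasurable (dirichlet_sum R n : G -> R[i]) := @cmeasurable_dirichlet_sum R m n.
elim: A => [|A IH].
  rewrite /L1norm; under eq_integral do
    rewrite /Mprod big_ord0 /dirichlet_sum big_ord1 /dirichlet big_ord0
      ComplexField.Normc.normc0.
  by rewrite integral0 lee_fin.
rewrite MprodS (mulnC (Mprod m A)).
rewrite (_ : dirichlet_sum R _ = fun t =>
  \sum_(b < m A) ((Mprod m A)%:R * dirichlet R (b * Mprod m A) t) +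
  (if t A == 0 then (m A)%:R else 0) * dirichlet_sum R (Mprod m A) t); last first.
  by apply/funext => t; rewrite dirichlet_sum_Mprod_mul// sum_rademacher.
have c1 : cmeasurable (fun t : G =>
    \sum_(b < m A) ((Mprod m A)%:R * dirichlet R (b * Mprod m A) t)).
  apply: cmeasurable_sum => b; apply: cmeasurableM; first exact: cmeasurable_cst.
  exact: cmeasurable_dirichlet.
have c2 : cmeasurable (fun t : G => (if t A == 0 then (m A)%:R else 0) : R[i]).
  rewrite (_ : (fun _ => _) = fun t : G => \sum_(b < m A) rademacher R A t ^+ b).
    exact: cmeasurable_sum_rademacher.
  by apply/funext => t; rewrite sum_rademacher.
apply: (le_trans (L1normD mu c1 (cmeasurableM c2 (cF _)))).
have -> : L1 (fun t => (if t A == 0 then (m A)%:R else 0) * dirichlet_sum R (Mprod m A) t) =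
    L1 (dirichlet_sum R (Mprod m A)).
  rewrite -[RHS](integral_coordinate_eq0 hm hmu (A := A)).
  - apply: eq_integral => t _; rewrite ComplexField.Normc.normcM; congr (_ * _)%:E.
    by case: ifP => _; rewrite ?normc_nat ?ComplexField.Normc.normc0.
  - exact: measurable_normc.
  - by move=> t; exact: normc_ge0.
  - by move=> s t; rewrite dirichlet_sum_vunit.
apply: (le_trans (leeD (L1_sum_dirichlet (leqnn _)) IH)).
rewrite -EFinD lee_fin -natrD ler_nat.
have := hm A; set M := Mprod m A; set k := m A => k2.
rewrite -mulnDr addnn -mul2n leq_mul2l leq_mul2r k2 !orbT//.
Qed.

(** Removing the top digit a of l leaves the sum of |F_(l')| and three errors, B^2 M_A, a B^2 M_A
    and l' a, each at most B^3 M_A. With c = 3 B^3 the induction closes by 2 c M_A <= c M_(A+1). The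
    factor a in front of F_(M_A) is harmless here, as that norm is already bounded and is not the
    induction hypothesis. *)
Lemma L1_dirichlet_sum A l : (l <= Mprod m A)%N ->
  (L1 (dirichlet_sum R l) <= (3 * B ^ 3 * Mprod m A)%:R%:E)%E.
Proof.
have cF n : cmeasurable (dirichlet_sum R n : G -> R[i]) := @cmeasurable_dirichlet_sum R m n.
have cD n : cmeasurable (dirichlet R n : G -> R[i]) := @cmeasurable_dirichlet R m n.
have B2 : (2 <= B)%N := leq_trans (hm 0) (hB 0).
have L1_Mprod A' : (L1 (dirichlet_sum R (Mprod m A')) <= (3 * B ^ 3 * Mprod m A')%:R%:E)%E.
  rewrite (le_trans (L1_dirichlet_sum_Mprod _))// lee_fin ler_nat leq_mul2r.
  apply/orP; right; rewrite !expnS expn0 muln1 mulnCA leq_mul2l mulnCA.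
  by rewrite leq_pmulr ?orbT// muln_gt0 /= (ltnW B2).
elim: A l => [|A IH] l.
  rewrite /Mprod big_ord0 leq_eqVlt => /predU1P[->|].
    by have := L1_Mprod 0%N; rewrite /Mprod big_ord0.
  rewrite ltnS leqn0 => /eqP ->.
  rewrite /L1norm; under eq_integral do
    rewrite /dirichlet_sum big_ord0 ComplexField.Normc.normc0.
  by rewrite integral0 lee_fin.
(* For l = M_(A+1) the quotient by M_A would be m_A, which is not a digit; this value is covered by
   [L1_Mprod]. *)
rewrite leq_eqVlt => /predU1P[->//|lA].
have M0 := Mprod_gt0 hm A.
set M := Mprod m A in M0 IH.
pose a := (l %/ M)%N; pose l' := (l %% M)%N.
have aA : (a < m A)%N by rewrite ltn_divLR// mulnC -MprodS.
have lM : (l' <= M)%N by rewrite ltnW// ltn_pmod.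
have lE : l = (a * M + l')%N by exact: divn_eq.
rewrite lE (_ : dirichlet_sum R _ = fun t =>
  (\sum_(b < a) (M%:R * dirichlet R (b * M) t) +
  (\sum_(b < a) rademacher R A t ^+ b) * dirichlet_sum R M t) +
  (l'%:R * dirichlet R (a * M) t + rademacher R A t ^+ a * dirichlet_sum R l' t)); last first.
  by apply/funext => t; rewrite dirichlet_sumD// dirichlet_sum_Mprod_mul// ltnW.
have cr : cmeasurable (rademacher R A : G -> R[i]) := @cmeasurable_rademacher R m A.
have c1 : cmeasurable (fun t : G => \sum_(b < a) (M%:R * dirichlet R (b * M) t)).
  apply: cmeasurable_sum => b; apply: cmeasurableM => //; exact: cmeasurable_cst.
have c2 : cmeasurable (fun t : G => (\sum_(b < a) rademacher R A t ^+ b) * dirichlet_sum R M t).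
  by apply: cmeasurableM => //; exact: cmeasurable_sum_rademacher.
have c3 : cmeasurable (fun t : G => l'%:R * dirichlet R (a * M) t).
  by apply: cmeasurableM => //; exact: cmeasurable_cst.
have c4 : cmeasurable (fun t : G => rademacher R A t ^+ a * dirichlet_sum R l' t).
  by apply: cmeasurableM => //; exact: cmeasurableX.
apply: (le_trans (L1normD mu (cmeasurableD c1 c2) (cmeasurableD c3 c4))).
apply: (@le_trans _ _ (((B * B * M)%:R%:E + a%:R%:E * (B * B * M)%:R%:E) +
   (l'%:R%:E * a%:R%:E + 1%:E * (3 * B ^ 3 * M)%:R%:E))%E).
  apply: leeD.
    apply: (le_trans (L1normD mu c1 c2)); apply: leeD.
      exact: (L1_sum_dirichlet (ltnW aA)).
    apply: (le_trans (L1normM mu (@cmeasurable_sum_rademacher R m A a) (cF M)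
      (@normc_sum_rademacher R m A a))).
    by rewrite lee_wpmul2l// L1_dirichlet_sum_Mprod.
  apply: (le_trans (L1normD mu c3 c4)); apply: leeD.
    apply: (le_trans (L1normM mu (cmeasurable_cst _) (cD _) (k := l'%:R) _)).
      by move=> x; rewrite normc_nat.
    by rewrite lee_wpmul2l// L1_dirichlet_mul// ltnW.
  apply: (le_trans (L1normM mu (cmeasurableX a cr) (cF _) (k := 1) _)).
    by move=> x; rewrite normcX normc_rademacher expr1n.
  by rewrite lee_wpmul2l ?IH.
rewrite -!EFinM -!EFinD lee_fin mul1r -!natrM -!natrD ler_nat MprodS -/M.
have aB : (a <= B)%N := leq_trans (ltnW aA) (hB A).
have k2 := hm A.
have E1 : (B * B * M <= B ^ 3 * M)%N.
  by rewrite leq_mul2r !expnS expn0 muln1 mulnA leq_pmulr ?orbT// ltnW.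
have E2 : (a * (B * B * M) <= B ^ 3 * M)%N.
  by rewrite !mulnA leq_mul2r !expnS expn0 muln1 !mulnA !leq_mul2r aB !orbT.
have E3 : (l' * a <= B ^ 3 * M)%N.
  rewrite mulnC; apply: leq_mul => //; apply: (leq_trans aB).
  by rewrite expnS leq_pmulr// expn_gt0 ltnW.
have E4 : (3 * B ^ 3 * (M * 2) <= 3 * B ^ 3 * (M * m A))%N.
  by rewrite !leq_mul2l k2 !orbT.
apply: leq_trans E4; rewrite muln2 -addnn mulnDr addnA leq_add2r.
apply: (leq_trans (leq_add (leq_add E1 E2) E3)).
by rewrite -mulnA (_ : 3 = 1 + 1 + 1)%N // !mulnDl mul1n.
Qed.

End FejerKernelBounds.

(** * The complex integral, its invariance, and the means of the characters *)

Section ComplexIntegral.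
Variables (R : realType) (m : nat -> nat).
Local Notation G := (vilenkin m).
Local Notation normc := ComplexField.Normc.normc.
Variable mu : probability G R.
Local Notation L1 := (L1norm mu).

Definition cintegrable (g : G -> R[i]) := cmeasurable g /\ (L1 g < +oo)%E.

Lemma cintegrable_bounded (g : G -> R[i]) (k : R) :
  cmeasurable g -> (forall x, normc (g x) <= k) -> cintegrable g.
Proof.
move=> mg gk; split => //; apply: (@le_lt_trans _ _ (\int[mu]_x (cst k x)%:E)%E).
  exact: le_L1norm.
rewrite (_ : (fun _ => _) = cst k%:E)// integral_cst// [X in (_ * X)%E](probability_setT mu) mule1.
exact: ltry.
Qed.

Lemma cintegrable_cst (c : R[i]) : cintegrable (fun=> c).
Proof. by apply: (@cintegrable_bounded _ (normc c)) => //; exact: cmeasurable_cst. Qed.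

Lemma cintegrableM (c g : G -> R[i]) (k : R) : cmeasurable c ->
  (forall x, normc (c x) <= k) -> cintegrable g -> cintegrable (fun x => c x * g x).
Proof.
move=> mc ck [mg g1]; split; first exact: cmeasurableM.
rewrite (le_lt_trans (L1normM mu mc mg ck))//.
by rewrite lte_mul_pinfty// lee_fin (le_trans (normc_ge0 _) (ck point)).
Qed.

Lemma cintegrableZ (c : R[i]) (g : G -> R[i]) :
  cintegrable g -> cintegrable (fun x => c * g x).
Proof. by apply: (@cintegrableM _ _ (normc c)) => //; exact: cmeasurable_cst. Qed.

Lemma cintegrableD (g h : G -> R[i]) :
  cintegrable g -> cintegrable h -> cintegrable (fun x => g x + h x).
Proof.
move=> [mg g1] [mh h1]; split; first exact: cmeasurableD.
by rewrite (le_lt_trans (L1normD mu mg mh))// lte_add_pinfty.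
Qed.

Lemma cintegrableB (g h : G -> R[i]) :
  cintegrable g -> cintegrable h -> cintegrable (fun x => g x - h x).
Proof.
move=> ig ih; rewrite (_ : (fun _ => _) = fun x => g x + (-1) * h x).
  by apply: cintegrableD => //; exact: cintegrableZ.
by apply/funext => x; rewrite mulN1r.
Qed.

Lemma cintegrable_sum (I : Type) (s : seq I) (F : I -> G -> R[i]) :
  (forall i, cintegrable (F i)) -> cintegrable (fun x => \sum_(i <- s) F i x).
Proof.
move=> iF; elim: s => [|i s IH].
  by under eq_fun do rewrite big_nil; exact: cintegrable_cst.
by under eq_fun do rewrite big_cons; exact: cintegrableD.
Qed.

Lemma cintegrable_Re (g : G -> R[i]) : cintegrable g ->
  mu.-integrable setT (EFin \o (fun x => complex.Re (g x))).
Proof.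
move=> [[g1 g2] goo]; apply/integrableP; split; first exact/measurable_EFinP.
apply: le_lt_trans goo; apply: ge0_le_integral => //.
- by apply: measurableT_comp => //; exact/measurable_EFinP.
- exact: measurable_normc_EFin.
- by move=> x _; rewrite lee_fin Re_le_normc.
Qed.

Lemma cintegrable_Im (g : G -> R[i]) : cintegrable g ->
  mu.-integrable setT (EFin \o (fun x => complex.Im (g x))).
Proof.
move=> [[g1 g2] goo]; apply/integrableP; split; first exact/measurable_EFinP.
apply: le_lt_trans goo; apply: ge0_le_integral => //.
- by apply: measurableT_comp => //; exact/measurable_EFinP.
- exact: measurable_normc_EFin.
- by move=> x _; rewrite lee_fin Im_le_normc.
Qed.

Lemma cintegralD (g h : G -> R[i]) : cintegrable g -> cintegrable h ->
  cintegral mu (fun x => g x + h x) = cintegral mu g + cintegral mu h.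
Proof.
move=> ig ih; rewrite /cintegral; congr Complex.
  rewrite -RintegralD//; try exact: cintegrable_Re.
  by apply: eq_Rintegral => x _; case: (g x) => ? ?; case: (h x).
rewrite -RintegralD//; try exact: cintegrable_Im.
by apply: eq_Rintegral => x _; case: (g x) => ? ?; case: (h x).
Qed.

Lemma cintegralZ (c : R[i]) (g : G -> R[i]) : cintegrable g ->
  cintegral mu (fun x => c * g x) = c * cintegral mu g.
Proof.
move=> ig; have iR := cintegrable_Re ig; have iI := cintegrable_Im ig.
have ZR (k : R) : mu.-integrable setT (EFin \o (fun x => k * complex.Re (g x))).
  exact: (integrableZl measurableT k iR).
have ZI (k : R) : mu.-integrable setT (EFin \o (fun x => k * complex.Im (g x))).
  exact: (integrableZl measurableT k iI).
case: c => a b; rewrite /cintegral; congr Complex.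
  rewrite -!RintegralZl// -RintegralB//.
  by apply: eq_Rintegral => x _; case: (g x).
rewrite -!RintegralZl// -RintegralD//.
by apply: eq_Rintegral => x _; case: (g x).
Qed.

Lemma cintegral_cst (c : R[i]) : cintegral mu (fun=> c) = c.
Proof.
case: c => a b; rewrite /cintegral /= !Rintegral_cst//.
by congr Complex; rewrite [X in fine X](probability_setT mu) mulr1.
Qed.

Lemma cintegral_sum (I : Type) (s : seq I) (F : I -> G -> R[i]) :
  (forall i, cintegrable (F i)) ->
  cintegral mu (fun x => \sum_(i <- s) F i x) = \sum_(i <- s) cintegral mu (F i).
Proof.
move=> iF; elim: s => [|i s IH].
  by rewrite big_nil; under eq_fun do rewrite big_nil; rewrite cintegral_cst.
rewrite big_cons -IH -cintegralD//; last exact: cintegrable_sum.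
by congr cintegral; apply/funext => x; rewrite big_cons.
Qed.

(* Rotating by the phase of the integral makes it equal to the integral of a real part. *)
Lemma normc_cintegral (g : G -> R[i]) : cintegrable g ->
  ((normc (cintegral mu g))%:E <= L1 g)%E.
Proof.
move=> ig; set I := cintegral mu g.
have [I0|I0] := eqVneq (normc I) 0; first by rewrite I0 L1norm_ge0.
pose c : R[i] := (I^* * ((normc I)^-1)%:C%C).
have nc : normc c = 1.
  rewrite ComplexField.Normc.normcM normc_conj normc_real ger0_norm ?invr_ge0 ?normc_ge0//.
  by rewrite mulfV.
have cI : complex.Re (c * I) = normc I.
  have -> : c * I = ((normc I ^+ 2) * (normc I)^-1)%:C%C.
    rewrite /c mulrAC (mulrC I^*) conjCE -sqr_normc.
    by rewrite -[`|I|]/((normc I)%:C%C) -rmorphXn -rmorphM.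
  by rewrite /= expr2 mulfK.
have icg := cintegrableZ c ig.
rewrite -cI -cintegralZ// /=.
have Ifin : (\int[mu]_x (complex.Re (c * g x))%:E)%E \is a fin_num.
  by apply: integrable_fin_num => //; exact: cintegrable_Re.
rewrite /Rintegral fineK//.
have cg x : normc (c * g x) = normc (g x).
  by rewrite ComplexField.Normc.normcM nc mul1r.
rewrite /L1norm; under [leRHS]eq_integral do rewrite -cg.
apply: le_integral => //; first exact: cintegrable_Re.
  apply/integrableP; split; first exact: measurable_normc_EFin (proj1 icg).
  under eq_integral do rewrite gee0_abs ?lee_fin ?normc_ge0//.
  exact: (proj2 icg).
by move=> x _; rewrite lee_fin (le_trans (ler_norm _))// Re_le_normc.
Qed.

Hypothesis hmu : is_product_of_uniform mu.

Lemma Rintegral_vadd (x : G) (g : G -> R) : measurable_fun setT g ->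
  \int[mu]_t g (vadd x t) = \int[mu]_t g t.
Proof.
move=> mg; rewrite /Rintegral; congr fine.
have mg' : measurable_fun setT (EFin \o g) by exact/measurable_EFinP.
rewrite [LHS]integralE [RHS]integralE; congr (_ - _)%E.
  rewrite -[RHS](ge0_integral_vadd hmu x)//; last exact: measurable_funepos.
  by apply: eq_integral => t _; rewrite unlock.
rewrite -[RHS](ge0_integral_vadd hmu x)//; last exact: measurable_funeneg.
by apply: eq_integral => t _; rewrite unlock.
Qed.

Lemma cintegral_vadd (x : G) (g : G -> R[i]) : cmeasurable g ->
  cintegral mu (fun t => g (vadd x t)) = cintegral mu g.
Proof.
move=> [g1 g2]; rewrite /cintegral; congr Complex.
  exact: (Rintegral_vadd x g1).
exact: (Rintegral_vadd x g2).
Qed.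

Lemma cmeasurable_vadd (x : G) (g : G -> R[i]) :
  cmeasurable g -> cmeasurable (fun t => g (vadd x t)).
Proof.
by move=> [g1 g2]; split; [move: g1|move: g2] => gi;
  exact: (measurableT_comp gi (@measurable_vaddr m x)).
Qed.

Lemma cintegrable_vadd (x : G) (g : G -> R[i]) : cintegrable g ->
  cintegrable (fun t => g (vadd x t)).
Proof.
move=> [mg g1]; split; first exact: cmeasurable_vadd.
rewrite /L1norm (ge0_integral_vadd hmu x (f := fun t => (normc (g t))%:E))//.
  exact: measurable_normc_EFin.
by move=> t; rewrite lee_fin normc_ge0.
Qed.

Hypothesis hm : forall k, (2 <= m k)%N.

Lemma cintegrable_psi_conj n (g : G -> R[i]) :
  cintegrable g -> cintegrable (fun t => g t * (psi R n t)^*).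
Proof.
move=> ig; under eq_fun do rewrite mulrC.
apply: (@cintegrableM _ _ 1) => //.
  by apply: cmeasurable_conj; exact: cmeasurable_psi.
by move=> x; rewrite normc_conj normc_psi.
Qed.

(** For n > 0 some digit k of n is nonzero. Translation by e_k leaves the integral unchanged and
    also multiplies it by a root of unity z different from 1, so the integral vanishes. *)
Lemma cintegral_psi_conj n : cintegral mu (fun t => (psi R n t)^*) = (n == 0)%:R.
Proof.
case: n => [|n].
  by under eq_fun do rewrite psi0 rmorph1; rewrite cintegral_cst.
have [k dk] : exists k, digit m n.+1 k != 0%N.
  apply: contrapT => /forallNP dk.
  have := digit_expansion hm (ltn_Mprod hm n.+1).
  rewrite big1 // => i _; have := dk i.
  by move=> /negP; rewrite negbK => /eqP ->.
have ic : cintegrable (fun t => (psi R n.+1 t)^*).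
  apply: (@cintegrable_bounded _ 1); last by move=> t; rewrite normc_conj normc_psi.
  by apply: cmeasurable_conj; exact: cmeasurable_psi.
pose z := (psi R n.+1 (vunit m k 1))^* : R[i].
have z1 : z != 1.
  rewrite /z psi_vunit// -root_unityM mul1n -[1](rmorph1 Num.conj).
  rewrite (inj_eq (can_inj (@conjCK _))) root_unity_neq1//.
  by rewrite lt0n dk/= ltn_pmod// ltnW.
have := cintegral_vadd (vunit m k 1) (proj1 ic).
under eq_fun do rewrite psi_vadd// rmorphM.
rewrite cintegralZ// -/z => /eqP; rewrite -subr_eq0 -[X in _ - X]mul1r -mulrBl mulf_eq0.
by rewrite subr_eq0 (negbTE z1)/= => /eqP.
Qed.

End ComplexIntegral.

(** * L^p norms of real functions *)

Section LnormFacts.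
Context d (T : measurableType d) (R : realType).
Variable mu : {measure set T -> \bar R}.
Local Open Scope ereal_scope.
Local Notation "'N_ p [ f ]" := (Lnorm mu p%:E (EFin \o f)).

Lemma le_Lnorm (p : R) (f g : T -> R) : (0 < p)%R ->
  measurable_fun setT f -> measurable_fun setT g ->
  (forall x, 0 <= f x <= g x)%R -> 'N_p[f] <= 'N_p[g].
Proof.
move=> p0 mf mg fg; rewrite unlock /Lnorm.
have mp (h : T -> R) : measurable_fun setT h ->
    measurable_fun setT (fun x => `|(EFin \o h) x| `^ p).
  move=> mh; apply: (measurableT_comp (measurable_poweR _)).
  by apply: measurableT_comp => //; exact/measurable_EFinP.
apply: gt0_ler_poweR; first by rewrite invr_ge0 ltW.
- by rewrite in_itv/= leey andbT; apply: integral_ge0 => x _; rewrite lee_fin powR_ge0.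
- by rewrite in_itv/= leey andbT; apply: integral_ge0 => x _; rewrite lee_fin powR_ge0.
apply: ge0_le_integral => //.
- by move=> x _; exact: poweR_ge0.
- exact: mp.
- exact: mp.
move=> x _; have /andP[f0 fgx] := fg x.
rewrite /= !ger0_norm ?(le_trans f0)// lee_fin ge0_ler_powR// ?nnegrE ?(ltW p0)//.
exact: le_trans fgx.
Qed.

Lemma LnormZl (p c : R) (f : T -> R) : (0 < p)%R -> (0 <= c)%R ->
  measurable_fun setT f -> 'N_p[(fun x => c * f x)%R] = c%:E * 'N_p[f].
Proof.
move=> p0 c0 mf; rewrite unlock /Lnorm.
under eq_integral => x _.
  rewrite /= normrM (ger0_norm c0) powRM// EFinM.
  over.
rewrite ge0_integralZl//; last 2 first.
- apply/measurable_EFinP; apply: (measurableT_comp (measurable_powR _)).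
  exact: measurableT_comp.
- by rewrite lee_fin powR_ge0.
rewrite poweRM ?lee_fin ?powR_ge0//; last first.
  by apply: integral_ge0 => x _; rewrite lee_fin powR_ge0.
by rewrite poweR_EFin -powRrM mulfV ?gt_eqF// powRr1.
Qed.

Lemma Lnorm_sum (I : Type) (s : seq I) (p : R) (F : I -> T -> R) : (1 <= p)%R ->
  (forall i, measurable_fun setT (F i)) ->
  'N_p[(fun x => \sum_(i <- s) F i x)%R] <= \sum_(i <- s) 'N_p[F i].
Proof.
move=> p1 mF; elim: s => [|i s IH].
  rewrite big_nil (_ : EFin \o _ = cst 0).
    by rewrite Lnorm0// eqe gt_eqF// (lt_le_trans ltr01).
  by apply/funext => x; rewrite /= big_nil.
rewrite big_cons (_ : EFin \o _ = EFin \o (F i \+ (fun x => \sum_(j <- s) F j x))%R).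
  rewrite (le_trans (minkowski_EFin mu (mF i) _ p1))//; last exact: leeD2l.
  exact: measurable_sum.
by apply/funext => x; rewrite /= big_cons.
Qed.

End LnormFacts.

(** * The modulus of continuity and translations by elements of I_A *)

Section VilenkinModulus.
Variables (R : realType) (m : nat -> nat).
Hypothesis hm : forall k, (2 <= m k)%N.
Local Notation G := (vilenkin m).
Local Notation normc := ComplexField.Normc.normc.

(* [t k / M_(k+1) <= 1 / M_k - 1 / M_(k+1)], so the sum telescopes; the vanishing
   digit makes the bound strict, which fails for [t k = m k - 1] at all [k >= A]. *)
Lemma vabs_lt (t : G) A j : (A <= j)%N -> (forall k, (k < A)%N -> t k = 0) ->
  t j = 0 -> (vabs R t < ((Mprod m A)%:R^-1)%:E)%E.
Proof.
move=> Aj tA tj.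
pose v k : R := (Mprod m k)%:R^-1.
have v0 k : 0 < v k by rewrite invr_gt0 ltr0n Mprod_gt0.
have vS k : v k.+1 < v k.
  rewrite ltf_pV2 ?posrE ?ltr0n ?Mprod_gt0// ltr_nat MprodS.
  by rewrite -{1}(muln1 (Mprod m k)) ltn_pmul2l ?Mprod_gt0.
have tv k : (t k : nat)%:R / (Mprod m k.+1)%:R <= v k - v k.+1.
  have tm : (t k < m k)%N by rewrite (leq_trans (ltn_ord (t k)))// Zp_cast.
  have -> : v k = (m k)%:R * v k.+1.
    rewrite /v MprodS natrM invfM mulrC -mulrA mulVf ?mulr1//.
    by rewrite pnatr_eq0 -lt0n ltnW.
  rewrite -[X in _ - X]mul1r -mulrBl ler_pM2r ?v0// lerBrDr.
  by rewrite natr1 ler_nat.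
pose w k := v (maxn k A).
have term k : (t k : nat)%:R / (Mprod m k.+1)%:R <=
    w k - w k.+1 - (if k == j then v j - v j.+1 else 0).
  rewrite /w; case: (ltnP k A) => kA.
    rewrite (maxn_idPr kA) tA// mul0r subrr sub0r.
    by rewrite ifF ?oppr0//; apply: contraTF kA => /eqP ->; rewrite -leqNgt.
  rewrite (maxn_idPl (leqW kA)).
  case: eqP => [->|_]; last by rewrite subr0.
  by rewrite tj mul0r subrr.
apply: (@le_lt_trans _ _ (v A - (v j - v j.+1))%:E); last first.
  by rewrite lte_fin -/(v A) ltrBlDr ltrDl subr_gt0.
rewrite /vabs; apply: lime_le.
  by apply: is_cvg_nneseries => k _ _; rewrite lee_fin divr_ge0.
exists j.+1 => // n /= jn; rewrite sumEFin lee_fin.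
apply: (@le_trans _ _ (\sum_(0 <= k < n)
    (w k - w k.+1 - (if k == j then v j - v j.+1 else 0)))).
  by apply: ler_sum => k _; exact: term.
rewrite sumrB -big_mkcond/= big_nat1_eq jn/=.
have -> : \sum_(0 <= k < n) (w k - w k.+1) = w 0 - w n.
  elim: n {jn} => [|n IH]; first by rewrite big_geq// subrr.
  by rewrite big_nat_recr//= IH addrA subrK.
rewrite lerD2r /w max0n gerBl ltW//.
Qed.

Variable mu : probability G R.
Hypothesis hmu : is_product_of_uniform mu.

Lemma cLnorm_vadd (p : R) (f : G -> R[i]) (x : G) : cmeasurable f ->
  cLnorm mu p (fun t => f (vadd t x)) = cLnorm mu p f.
Proof.
move=> mf; rewrite /cLnorm unlock /Lnorm; congr (_ `^ _)%E.
rewrite -[RHS](ge0_integral_vadd hmu x); last 2 first.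
- apply: (measurableT_comp (measurable_poweR _)).
  by apply: measurableT_comp => //; exact: measurable_normc_EFin.
- by move=> t; exact: poweR_ge0.
by apply: eq_integral => t _; rewrite vaddC.
Qed.

Lemma cLnormD (p : R) (f g : G -> R[i]) : 1 <= p -> cmeasurable f -> cmeasurable g ->
  (cLnorm mu p (fun x => f x + g x)%R <= cLnorm mu p f + cLnorm mu p g)%E.
Proof.
move=> p1 mf mg.
have mf' := measurable_normc mf; have mg' := measurable_normc mg.
apply: le_trans (minkowski_EFin mu mf' mg' p1); apply: le_Lnorm.
- exact: lt_le_trans p1.
- exact/measurable_normc/cmeasurableD.
- exact: measurable_funD.
- by move=> x; rewrite normc_ge0 normcD.
Qed.

Lemma modulus_ub (p delta : R) (f : G -> R[i]) (t : G) :
  (vabs R t < delta%:E)%E ->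
  (cLnorm mu p (fun x => f (vadd x t) - f x)%R <= modulus mu p delta f)%E.
Proof. by move=> td; apply: ereal_sup_ubound; exists t. Qed.

Lemma vabs_vunit A s : (vabs R (vunit m A s) < ((Mprod m A)%:R^-1)%:E)%E.
Proof.
apply: (@vabs_lt _ A A.+1) => [//|k kA|]; rewrite /vunit.
  by rewrite ltn_eqF.
by rewrite gtn_eqF.
Qed.

Lemma modulus_ge0 (p : R) A (f : G -> R[i]) :
  (0 <= modulus mu p (Mprod m A)%:R^-1 f)%E.
Proof. by apply: le_trans (modulus_ub p f (vabs_vunit A 0)); exact: Lnorm_ge0. Qed.

(* The single point of [I_A] with [|t| = 1 / M_A] is not covered by [modulus];
   splitting off the digit [t A] avoids it. *)
Lemma cLnorm_shift_le (p : R) A (f : G -> R[i]) (t : G) :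
  1 <= p -> cmeasurable f -> (forall k, (k < A)%N -> t k = 0) ->
  (cLnorm mu p (fun x => f (vadd x t) - f x)%R <=
   2%:E * modulus mu p (Mprod m A)%:R^-1 f)%E.
Proof.
move=> p1 mf tA.
pose e : G := fun k => if k == A then t k else 0.
pose u : G := fun k => if k == A then 0 else t k.
have tE x : vadd x t = vadd (vadd x e) u.
  rewrite -vaddA; congr vadd; apply: functional_extensionality_dep => k.
  by rewrite /vadd /e /u; case: eqP; rewrite ?addr0 ?add0r.
have e1 : (vabs R e < ((Mprod m A)%:R^-1)%:E)%E.
  apply: (@vabs_lt _ A A.+1) => [//|k kA|]; rewrite /e; first by rewrite ltn_eqF.
  by rewrite gtn_eqF.
have u1 : (vabs R u < ((Mprod m A)%:R^-1)%:E)%E.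
  apply: (@vabs_lt _ A A) => [//|k kA|]; rewrite /u; last by rewrite eqxx.
  by rewrite ltn_eqF// tA.
have mft (s : G) : cmeasurable (fun x : G => f (vadd x s)).
  by under eq_fun do rewrite vaddC; exact: cmeasurable_vadd.
rewrite (_ : (fun x => _) = fun x =>
    (f (vadd (vadd x e) u) - f (vadd x e)) + (f (vadd x e) - f x)); last first.
  by apply/funext => x; rewrite tE addrA subrK.
have mg : cmeasurable (fun x : G => f (vadd x u) - f x) by exact: cmeasurableB.
apply: (le_trans (cLnormD p1 _ _)).
- by under eq_fun do rewrite (vaddC _ e);
    exact: (cmeasurable_vadd e mg).
- exact: cmeasurableB.
rewrite (cLnorm_vadd p e mg).
by rewrite mule_natl mule2n; apply: leeD; exact: modulus_ub.
Qed.

End VilenkinModulus.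

(** * Increments of f integrated against a kernel *)

Section DirichletOperator.
Variables (R : realType) (m : nat -> nat).
Hypothesis hm : forall k, (2 <= m k)%N.
Local Notation G := (vilenkin m).
Local Notation normc := ComplexField.Normc.normc.
Variable mu : probability G R.
Hypothesis hmu : is_product_of_uniform mu.
Local Notation L1 := (L1norm mu).

(** The class of admissible kernels: their products with the integrable increments of f stay
    integrable, which gives linearity of [kernel_op] in the kernel. *)
Definition cbounded (g : G -> R[i]) :=
  cmeasurable g /\ exists k : R, forall x, normc (g x) <= k.

Lemma cbounded_cst (c : R[i]) : cbounded (fun=> c).
Proof. by split; [exact: cmeasurable_cst|exists (normc c)]. Qed.

Lemma cboundedD (g h : G -> R[i]) :
  cbounded g -> cbounded h -> cbounded (fun x => g x + h x).
Proof.
move=> [mg [k gk]] [mh [l hl]]; split; first exact: cmeasurableD.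
by exists (k + l) => x; rewrite (le_trans (normcD _ _))// lerD.
Qed.

Lemma cboundedM (g h : G -> R[i]) :
  cbounded g -> cbounded h -> cbounded (fun x => g x * h x).
Proof.
move=> [mg [k gk]] [mh [l hl]]; split; first exact: cmeasurableM.
by exists (k * l) => x; rewrite ComplexField.Normc.normcM ler_pM ?normc_ge0.
Qed.

Lemma cbounded_sum (I : Type) (s : seq I) (F : I -> G -> R[i]) :
  (forall i, cbounded (F i)) -> cbounded (fun x => \sum_(i <- s) F i x).
Proof.
move=> bF; elim: s => [|i s IH].
  by under eq_fun do rewrite big_nil; exact: cbounded_cst.
by under eq_fun do rewrite big_cons; exact: cboundedD.
Qed.

Lemma cbounded_psi n : cbounded (psi R n : G -> R[i]).
Proof. by split; [exact: cmeasurable_psi|exists 1 => x; rewrite normc_psi]. Qed.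

Lemma cbounded_dirichlet n : cbounded (dirichlet R n : G -> R[i]).
Proof. by apply: cbounded_sum => i; exact: cbounded_psi. Qed.

Lemma cbounded_dirichlet_sum n : cbounded (dirichlet_sum R n : G -> R[i]).
Proof. by apply: cbounded_sum => i; exact: cbounded_dirichlet. Qed.

Lemma cbounded_rademacherX A a : cbounded (fun t : G => rademacher R A t ^+ a).
Proof.
split; first by apply: cmeasurableX; exact: cmeasurable_rademacher.
by exists 1 => x; rewrite normcX normc_rademacher expr1n.
Qed.

Lemma cintegrable_mul_conj (g k : G -> R[i]) :
  cintegrable mu g -> cbounded k -> cintegrable mu (fun t => g t * (k t)^*).
Proof.
move=> ig [mk [c kc]]; under eq_fun do rewrite mulrC.
apply: (@cintegrableM _ _ _ _ _ c) => //; first exact: cmeasurable_conj.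
by move=> x; rewrite normc_conj.
Qed.

Variable f : G -> R[i].
Hypothesis fi : cintegrable mu f.

Let mf : cmeasurable f := proj1 fi.

(** Convolution of f with D_n, written at u = x + t, integrates f(x + t) against the conjugate of
    D_n(t). Having f(x) subtracted inside the integral lets each piece of a decomposed kernel act on
    increments separately, whatever its mean. *)
Definition kernel_op (k : G -> R[i]) (x : G) : R[i] :=
  cintegral mu (fun t => (f (vadd x t) - f x) * (k t)^*).

Lemma cintegrable_increment x : cintegrable mu (fun t => f (vadd x t) - f x).
Proof. by apply: cintegrableB; [exact: cintegrable_vadd|exact: cintegrable_cst]. Qed.

Lemma kernel_opD (k l : G -> R[i]) x : cbounded k -> cbounded l ->
  kernel_op (fun t => k t + l t) x = kernel_op k x + kernel_op l x.
Proof.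
move=> bk bl; rewrite /kernel_op.
under eq_fun do rewrite rmorphD/= mulrDr.
by rewrite cintegralD//; apply: cintegrable_mul_conj => //; exact: cintegrable_increment.
Qed.

Lemma kernel_op_sum (I : Type) (s : seq I) (F : I -> G -> R[i]) x :
  (forall i, cbounded (F i)) ->
  kernel_op (fun t => \sum_(i <- s) F i t) x = \sum_(i <- s) kernel_op (F i) x.
Proof.
move=> bF; rewrite /kernel_op.
under eq_fun do rewrite rmorph_sum/= mulr_sumr.
by rewrite cintegral_sum// => i; apply: cintegrable_mul_conj => //; exact: cintegrable_increment.
Qed.

(** Only the character of index 0 has nonzero mean, so f(x) is subtracted exactly once. For k = 0
    that character is absent and the operator is zero. *)
Lemma kernel_op_dirichlet k x : (0 < k)%N ->
  kernel_op (dirichlet R k) x = partial_sum mu k f x - f x.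
Proof.
move=> k0; rewrite /dirichlet kernel_op_sum; last by move=> i; exact: cbounded_psi.
have E (i : 'I_k) : kernel_op (psi R i) x =
    fourier_coef mu f i * psi R i x - f x * (i == 0%N :> nat)%:R.
  have ifv := cintegrable_vadd hmu x fi.
  rewrite /kernel_op; under eq_fun do rewrite mulrBl -mulNr.
  rewrite cintegralD; last 2 first.
  - exact: cintegrable_psi_conj.
  - by apply: cintegrable_psi_conj; exact: cintegrable_cst.
  rewrite cintegralZ; last first.
    apply: (@cintegrable_bounded _ _ _ _ 1); last by move=> t; rewrite normc_conj normc_psi.
    by apply: cmeasurable_conj; exact: cmeasurable_psi.
  rewrite cintegral_psi_conj// mulNr; congr (_ - _).
  have mg : cmeasurable (fun t : G => f t * (psi R i t)^*).
    by case: (cintegrable_psi_conj i fi).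
  (* Substituting x + t in the coefficient splits off the conjugate of psi_i(x), which cancels
     against psi_i(x). *)
  rewrite /fourier_coef -(cintegral_vadd hmu x mg) mulrC -cintegralZ; last first.
    exact: (cintegrable_vadd hmu x (cintegrable_psi_conj i fi)).
  congr cintegral; apply/funext => t.
  rewrite psi_vadd// rmorphM/= mulrCA; congr (_ * _).
  rewrite mulrA (_ : psi R i x * (psi R i x)^* = 1) ?mul1r//.
  rewrite conjCE -sqr_normc -[`|_|]/((normc (psi R i x))%:C%C) normc_psi.
  by rewrite rmorph1 expr1n.
rewrite (eq_bigr _ (fun i _ => E i)) sumrB; congr (_ - _).
rewrite (bigD1 (Ordinal k0))//= mulr1 big1 ?addr0// => i i0.
by rewrite (_ : (i == 0%N :> nat) = false) ?mulr0//; exact: negbTE i0.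
Qed.

Lemma kernel_op_dirichlet0 x : kernel_op (dirichlet R 0) x = 0.
Proof.
rewrite /kernel_op /dirichlet; under eq_fun do rewrite big_ord0 rmorph0 mulr0.
by rewrite cintegral_cst.
Qed.

Lemma cmeasurable_partial_sum k : cmeasurable (partial_sum mu k f).
Proof.
apply: cmeasurable_sum => i; apply: cmeasurableM; first exact: cmeasurable_cst.
exact: cmeasurable_psi.
Qed.

Lemma cmeasurable_kernel_op_dirichlet k : cmeasurable (kernel_op (dirichlet R k)).
Proof.
case: k => [|k].
  rewrite (_ : kernel_op _ = fun=> 0); first exact: cmeasurable_cst.
  by apply/funext => x; exact: kernel_op_dirichlet0.
rewrite (_ : kernel_op _ = fun x => partial_sum mu k.+1 f x - f x); last first.
  by apply/funext => x; exact: kernel_op_dirichlet.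
by apply: cmeasurableB => //; exact: cmeasurable_partial_sum.
Qed.

Lemma kernel_op_dirichlet_sum n x : kernel_op (dirichlet_sum R n) x =
  \sum_(k < n) kernel_op (dirichlet R k) x.
Proof. by apply: kernel_op_sum => i; exact: cbounded_dirichlet. Qed.

Lemma cmeasurable_kernel_op_dirichlet_sum n :
  cmeasurable (kernel_op (dirichlet_sum R n)).
Proof.
rewrite (_ : kernel_op _ = fun x => \sum_(k < n) kernel_op (dirichlet R k) x).
  by apply: cmeasurable_sum => k; exact: cmeasurable_kernel_op_dirichlet.
by apply/funext => x; exact: kernel_op_dirichlet_sum.
Qed.

End DirichletOperator.

(** * L^p estimates for the operators with kernel F_n *)

Section FejerApproximation.
Variables (R : realType) (m : nat -> nat).
Hypothesis hm : forall k, (2 <= m k)%N.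
Local Notation G := (vilenkin m).
Local Notation normc := ComplexField.Normc.normc.
Variable mu : probability G R.
Hypothesis hmu : is_product_of_uniform mu.
Local Notation L1 := (L1norm mu).
Variable B : nat.
Hypothesis hB : forall k, (m k <= B)%N.
Variable p : R.
Hypothesis hp : 1 <= p.

Let m_gt0 k : (0 < m k)%N. Proof. exact: ltnW. Qed.
Let p_gt0 : 0 < p. Proof. exact: lt_le_trans hp. Qed.

Lemma in_Lp_cintegrable (f : G -> R[i]) : in_Lp mu p f -> cintegrable mu f.
Proof.
move=> [f1 f2 fp]; have mf : cmeasurable f by [].
split=> //.
have fLp : (fun x => normc (f x)) \in Lfun mu p%:E.
  rewrite inE; apply/andP; split; rewrite inE//=; exact: measurable_normc.
have p1 : (1 <= p%:E)%E by rewrite lee_fin.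
have muT : mu setT \is a fin_num by exact: fin_num_measure.
have := @Lfun_subset _ _ _ mu 1%E p%:E (lexx _) p1 muT p1 _ fLp.
rewrite Lfun1_integrable => /integrableP[_].
apply: le_lt_trans; rewrite le_eqVlt; apply/orP; left; apply/eqP.
by apply: eq_integral => x _ /=; rewrite ger0_norm ?normc_ge0.
Qed.

(** Minkowski's inequality in the form used for both kernel terms. H stays arbitrary since one term
    needs f(x + t) - f(x) and the other f(x + t + s e_A) - f(x + t). The result is a real majorant
    J, measurable by Tonelli and finite because H(x, .) is integrable. *)
Lemma kernel_average_bound (k : G -> R[i]) (H : G * G -> R[i]) (c : R) (w : \bar R) :
  cbounded k -> cmeasurable H -> (forall x, cintegrable mu (fun t => H (x, t))) ->
  0 < c -> (0 <= w)%E -> (L1 k <= c%:E)%E ->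
  (forall t, k t != 0 -> (cLnorm mu p (fun x => H (x, t)) <= w)%E) ->
  exists J : G -> R, [/\ measurable_fun setT J,
    forall x, L1 (fun t => H (x, t) * (k t)^*) = (J x)%:E &
    (Lnorm mu p%:E (EFin \o J) <= c%:E * w)%E].
Proof.
move=> bk mH iH c0 w0 kc Hw.
pose K (t : G) := normc (k t); pose H' z := normc (H z).
have mK : measurable_fun setT K by apply: measurable_normc; case: bk.
have mH' : measurable_fun setT H' by exact: measurable_normc.
pose J x := fine (L1 (fun t => H (x, t) * (k t)^*)).
have JE x : L1 (fun t => H (x, t) * (k t)^*) = (J x)%:E.
  rewrite fineK// ge0_fin_numE ?L1norm_ge0//.
  by case: (cintegrable_mul_conj (iH x) bk).
have LE x : L1 (fun t => H (x, t) * (k t)^*) = (\int[mu]_t (K t * H' (x, t))%:E)%E.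
  apply: eq_integral => t _.
  by rewrite ComplexField.Normc.normcM normc_conj mulrC.
have JF : EFin \o J = fun x => (\int[mu]_t (K t * H' (x, t))%:E)%E.
  by apply/funext => x; rewrite /= -JE LE.
exists J; split => //.
  apply/measurable_EFinP; rewrite JF.
  apply: (@measurable_fun_fubini_tonelli_F _ _ _ _ _ mu
    (fun z : G * G => (K z.2 * H' z)%:E)).
    apply/measurable_EFinP; apply: measurable_funM => //.
    exact: measurableT_comp.
  by move=> z; rewrite lee_fin mulr_ge0 ?normc_ge0.
rewrite JF; apply: minkowski_integral => //.
- by move=> t; exact: normc_ge0.
- by move=> z; exact: normc_ge0.
move=> t kt; apply: Hw; apply: contraNneq kt => kt.
by rewrite /K kt ComplexField.Normc.normc0.
Qed.

Variable f : G -> R[i].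
Hypothesis fi : cintegrable mu f.

Let mf : cmeasurable f := proj1 fi.
Local Notation T := (kernel_op mu f).
Local Notation omega A := (modulus mu p (Mprod m A)%:R^-1 f).

Let mfvadd : cmeasurable (fun z : G * G => f (vadd z.1 z.2)).
Proof.
by case: mf => f1 f2; split;
  [exact: (measurableT_comp f1 (@measurable_vadd m))
  |exact: (measurableT_comp f2 (@measurable_vadd m))].
Qed.

(** The kernel has L^1 norm at most l a <= B M_A and lives on I_A, where [cLnorm_shift_le] bounds
    the increments; the factor 2 comes from there. *)
Lemma kernel_op_dirichlet_bound A a l : (a < m A)%N -> (l <= Mprod m A)%N ->
  exists J : G -> R, [/\ measurable_fun setT J,
    forall x, normc (T (fun t => l%:R * dirichlet R (a * Mprod m A) t) x) <= J x &
    (Lnorm mu p%:E (EFin \o J) <= (2 * B * Mprod m A)%:R%:E * omega A)%E].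
Proof.
move=> aA lA; have M0 := Mprod_gt0 hm A.
have B0 : (0 < B)%N := leq_trans (m_gt0 0) (hB 0).
pose k (t : G) : R[i] := l%:R * dirichlet R (a * Mprod m A) t.
have bk : cbounded k.
  by apply: cboundedM; [exact: cbounded_cst|exact: cbounded_dirichlet].
pose H (z : G * G) := f (vadd z.1 z.2) - f z.1.
have mH : cmeasurable H.
  apply: cmeasurableB => //.
  by case: mf => f1 f2; split; [exact: measurableT_comp f1 _|exact: measurableT_comp f2 _].
have [] := @kernel_average_bound k H (B * Mprod m A)%:R (2%:E * omega A)%E bk mH.
- by move=> x; exact: cintegrable_increment.
- by rewrite ltr0n muln_gt0 B0.
- by rewrite mule_ge0// modulus_ge0.
- have nl (x : G) : normc (l%:R : R[i]) <= l%:R by rewrite normc_nat.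
  rewrite (le_trans (L1normM mu (cmeasurable_cst _) (@cmeasurable_dirichlet R m _) nl))//.
  rewrite (mulnC B) natrM EFinM.
  apply: lee_pmul => //; first exact: L1norm_ge0.
    by rewrite lee_fin ler_nat.
  rewrite (le_trans (L1_dirichlet_mul hm hmu (ltnW aA)))// lee_fin ler_nat.
  exact: leq_trans (ltnW aA) (hB A).
- move=> t kt; apply: cLnorm_shift_le => // j jA.
  apply: contraNeq kt => tj; rewrite /k dirichletM ?(ltnW aA)// dirichlet_Mprod//.
  rewrite asboolF ?mulr0// => t0; move/eqP: tj; apply; exact: t0.
move=> J [mJ JE Jw]; exists J; split => //.
  move=> x; rewrite -lee_fin -JE; apply: normc_cintegral.
  exact: cintegrable_mul_conj (cintegrable_increment hmu fi x) bk.
rewrite (le_trans Jw)// muleA -EFinM -natrM (mulnC _ 2) mulnA//.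
Qed.

(* [sum_s r_A^a (s e_A) = 0], so averaging over the shifts [s e_A] replaces
   [f (x + t) - f x] by the increments [f (x + t + s e_A) - f (x + t)]. *)
Lemma kernel_op_rademacher_average A a l x : (0 < a < m A)%N -> (l <= Mprod m A)%N ->
  let k t := rademacher R A t ^+ a * dirichlet_sum R l t in
  (m A)%:R * T k x = \sum_(s < m A) (root_unity R (m A) s ^+ a)^* *
    cintegral mu (fun t => (f (vadd (vadd x t) (vunit m A s)) - f (vadd x t)) * (k t)^*).
Proof.
move=> /andP[a0 aA] lA k.
have bk : cbounded k.
  by apply: cboundedM; [exact: cbounded_rademacherX|exact: cbounded_dirichlet_sum].
have kv s t : k (vadd (vunit m A s) t) = root_unity R (m A) s ^+ a * k t.
  rewrite /k rademacher_vadd// rademacher_vunit// eqxx exprMn mulrA.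
  by rewrite vaddC dirichlet_sum_vunit.
have ig := cintegrable_increment hmu fi x.
have igv s : cintegrable mu (fun t => f (vadd (vadd x t) (vunit m A s)) - f x).
  have := cintegrable_vadd hmu (vunit m A s) ig.
  by congr cintegrable; apply/funext => t; rewrite -vaddA (vaddC t).
have shift s : T k x = (root_unity R (m A) s ^+ a)^* *
    cintegral mu (fun t => (f (vadd (vadd x t) (vunit m A s)) - f x) * (k t)^*).
  have [mgk _] := cintegrable_mul_conj ig bk.
  rewrite /kernel_op -(cintegral_vadd hmu (vunit m A s) mgk) -cintegralZ; last first.
    exact: cintegrable_mul_conj.
  congr cintegral; apply/funext => t.
  by rewrite kv rmorphM/= mulrCA -(vaddA x t) (vaddC t).
have sum0 : \sum_(s < m A) (root_unity R (m A) s ^+ a)^* = 0.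
  rewrite -rmorph_sum/=; under eq_bigr do rewrite -root_unityM mulnC root_unityM.
  by rewrite sum_root_unity ?rmorph0// root_unity_neq1// a0.
have -> : (m A)%:R * T k x = \sum_(s < m A) T k x.
  by rewrite sumr_const card_ord mulr_natl.
transitivity (\sum_(s < m A) (T k x - (root_unity R (m A) s ^+ a)^* * T k x)).
  by rewrite sumrB -mulr_suml sum0 mul0r subr0.
apply: eq_bigr => s _; rewrite {1}(shift s) -mulrBr; congr (_ * _).
rewrite /kernel_op -mulN1r -cintegralZ; last exact: cintegrable_mul_conj.
rewrite -cintegralD; last 2 first.
- exact: cintegrable_mul_conj.
- by apply: cintegrableZ; exact: cintegrable_mul_conj.
congr cintegral; apply/funext => t; ring.
Qed.

(** Each of the m_A <= B averaged terms is bounded by the L^1 norm of F_l, at most 3 B^3 M_A, times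
    the modulus at 1/M_A. *)
Lemma kernel_op_rademacher_bound A a l : (0 < a < m A)%N -> (l <= Mprod m A)%N ->
  exists J : G -> R, [/\ measurable_fun setT J,
    forall x, normc (T (fun t => rademacher R A t ^+ a * dirichlet_sum R l t) x) <= J x &
    (Lnorm mu p%:E (EFin \o J) <= (B * (3 * B ^ 3 * Mprod m A))%:R%:E * omega A)%E].
Proof.
move=> aA lA; have M0 := Mprod_gt0 hm A.
have B0 : (0 < B)%N := leq_trans (m_gt0 0) (hB 0).
pose k (t : G) : R[i] := rademacher R A t ^+ a * dirichlet_sum R l t.
have bk : cbounded k.
  by apply: cboundedM; [exact: cbounded_rademacherX|exact: cbounded_dirichlet_sum].
pose v s : G := vunit m A s.
pose H s (z : G * G) := f (vadd (vadd z.1 z.2) (v s)) - f (vadd z.1 z.2).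
have mg s : cmeasurable (fun x : G => f (vadd x (v s)) - f x).
  apply: cmeasurableB => //.
  by rewrite (_ : (fun _ => _) = fun x : G => f (vadd (v s) x));
    [exact: cmeasurable_vadd|apply/funext => x; rewrite vaddC].
have mH s : cmeasurable (H s).
  by case: (mg s) => g1 g2; split;
    [exact: (measurableT_comp g1 (@measurable_vadd m))
    |exact: (measurableT_comp g2 (@measurable_vadd m))].
have iH s x : cintegrable mu (fun t => H s (x, t)).
  apply: cintegrableB; last exact: cintegrable_vadd.
  have := cintegrable_vadd hmu (vadd x (v s)) fi.
  by congr cintegrable; apply/funext => t; rewrite /= -!vaddA (vaddC t).
have c0 : 0 < (3 * B ^ 3 * Mprod m A)%:R :> R by rewrite ltr0n !muln_gt0 B0 M0.
have L1k : (L1 k <= (3 * B ^ 3 * Mprod m A)%:R%:E)%E.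
  have nr (x : G) : normc (rademacher R A x ^+ a) <= 1.
    by rewrite normcX normc_rademacher expr1n.
  have cr := cmeasurableX a (@cmeasurable_rademacher R m A).
  rewrite (le_trans (L1normM mu cr (@cmeasurable_dirichlet_sum R m l) nr))// mul1e.
  exact: L1_dirichlet_sum.
(* For fixed t, the function x |-> H s (x, t) is a translate of the increment by s e_A. Its norm is
   thus at most omega A for every t, also far outside I_A, where F_l need not vanish. *)
have Hw s (t : G) : k t != 0 -> (cLnorm mu p (fun x => H s (x, t)) <= omega A)%E.
  move=> _; rewrite (cLnorm_vadd hmu p t (mg s)).
  by apply: modulus_ub; exact: vabs_vunit.
have [J HJ] := choice (fun s => kernel_average_bound bk (mH s) (iH s) c0
  (modulus_ge0 hm mu p A f) L1k (Hw s)).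
exists (fun x => \sum_(s < m A) J s x); split.
- by apply: measurable_sum => s; case: (HJ s).
(* The division by m_A in the average is given up, at the price of one factor B in the constant. *)
- move=> x; apply: (@le_trans _ _ (normc ((m A)%:R * T k x))).
    by rewrite ComplexField.Normc.normcM normc_nat ler_peMl ?normc_ge0// ler1n.
  rewrite kernel_op_rademacher_average// (le_trans (normc_sum _ _ _))// ler_sum// => s _.
  have [_ JE _] := HJ s.
  rewrite ComplexField.Normc.normcM normc_conj normcX normc_expi expr1n mul1r.
  rewrite -lee_fin -JE; apply: normc_cintegral.
  exact: cintegrable_mul_conj (iH s x) bk.
- apply: (le_trans (Lnorm_sum mu (F := fun s : 'I_(m A) => J s) _ hp _)).
    by move=> s; case: (HJ s).
  apply: (@le_trans _ _ (\sum_(s < m A) (3 * B ^ 3 * Mprod m A)%:R%:E * omega A)%E).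
    by apply: lee_sum => s _; case: (HJ s).
  rewrite -ge0_sume_distrl//.
  rewrite sumEFin sumr_const card_ord lee_wpmul2r ?modulus_ge0// lee_fin.
  by rewrite -mulrnA mulnC ler_nat leq_mul2r hB orbT.
Qed.

Local Notation sigma n := (T (dirichlet_sum R n)).
(** The summand 2 B comes from the kernel l D_(a M_A), and 3 B^4 = B (3 B^3) from r_A^a F_l. *)
Let K := (2 * B + 3 * B ^ 4)%N.

(** The cost of dropping the last l indices does not depend on l. The condition a > 0 gives r_A^a
    mean zero in t_A. *)
Lemma cLnorm_sigma_step A a l : (0 < a < m A)%N -> (l <= Mprod m A)%N ->
  (cLnorm mu p (sigma (a * Mprod m A + l)) <=
   cLnorm mu p (sigma (a * Mprod m A)) + (K * Mprod m A)%:R%:E * omega A)%E.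
Proof.
move=> aA lA; have /andP[_ aA'] := aA.
have [J1 [mJ1 J1x J1w]] := kernel_op_dirichlet_bound aA' lA.
have [J2 [mJ2 J2x J2w]] := kernel_op_rademacher_bound aA lA.
have ms n : cmeasurable (sigma n) by exact: cmeasurable_kernel_op_dirichlet_sum.
have mns n := measurable_normc (ms n).
have bk1 : cbounded (fun t : G => l%:R * dirichlet R (a * Mprod m A) t).
  by apply: cboundedM; [exact: cbounded_cst|exact: cbounded_dirichlet].
have bk2 : cbounded (fun t : G => rademacher R A t ^+ a * dirichlet_sum R l t).
  by apply: cboundedM; [exact: cbounded_rademacherX|exact: cbounded_dirichlet_sum].
have mJ : measurable_fun setT (J1 \+ J2) by exact: measurable_funD.
have le_J : (cLnorm mu p (sigma (a * Mprod m A + l)) <= Lnorm mu p%:E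
    (EFin \o ((fun x => normc (sigma (a * Mprod m A) x)) \+ (J1 \+ J2))%R))%E.
  apply: le_Lnorm => //.
    exact: measurable_funD.
  move=> x; apply/andP; split; first exact: normc_ge0.
  have -> : sigma (a * Mprod m A + l) x = sigma (a * Mprod m A) x +
      (T (fun t => l%:R * dirichlet R (a * Mprod m A) t) x +
       T (fun t => rademacher R A t ^+ a * dirichlet_sum R l t) x).
    rewrite -(kernel_opD hmu fi x bk1 bk2).
    rewrite -(kernel_opD hmu fi x (@cbounded_dirichlet_sum R m _) (cboundedD bk1 bk2)).
    by congr kernel_op; apply/funext => t; exact: dirichlet_sumD.
  rewrite (le_trans (normcD _ _))// lerD2l.
  by rewrite (le_trans (normcD _ _))// lerD.
apply: (le_trans le_J); apply: (le_trans (minkowski_EFin mu (mns _) mJ hp)).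
apply: leeD => //; apply: (le_trans (minkowski_EFin mu mJ1 mJ2 hp)).
apply: (le_trans (leeD J1w J2w)).
rewrite -ge0_muleDl ?lee_fin// -EFinD -natrD lee_wpmul2r ?modulus_ge0// lee_fin ler_nat.
rewrite (_ : (2 * B * Mprod m A + B * (3 * B ^ 3 * Mprod m A))%N = (K * Mprod m A)%N)//.
by rewrite /K; ring.
Qed.

Lemma cLnorm_sigma N n : (n <= Mprod m N)%N ->
  (cLnorm mu p (sigma n) <=
   (B * K)%:R%:E * \sum_(j < N) (Mprod m j)%:R%:E * omega j)%E.
Proof.
have term0 j : (0 <= (Mprod m j)%:R%:E * omega j)%E.
  by rewrite mule_ge0// modulus_ge0.
elim: N n => [|N IH] n nN.
  (* Here n <= M_0 = 1, and F_0 and F_1 = D_0 are both zero. *)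
  have -> : sigma n = fun=> 0.
    apply/funext => x; rewrite kernel_op_dirichlet_sum//.
    move: nN; rewrite /Mprod big_ord0; case: n => [|[|//]] _; first by rewrite big_ord0.
    by rewrite big_ord1 kernel_op_dirichlet0.
  rewrite big_ord0 mule0 /cLnorm ComplexField.Normc.normc0.
  by rewrite [X in (X <= _)%E](Lnorm0 mu (p := p%:E))// eqe gt_eqF.
rewrite big_ord_recr/= ge0_muleDr//; last by apply: sume_ge0 => j _; exact: term0.
have M0 := Mprod_gt0 hm N.
have [nM|Mn] := leqP n (Mprod m N).
  by rewrite (le_trans (IH _ nM))// leeDl// mule_ge0.
(* Dividing n - 1 instead of n gives 1 <= l <= M_N and keeps a a digit even at the endpoint n =
   M_(N+1); n > M_N ensures a > 0. *)
pose a := (n.-1 %/ Mprod m N)%N; pose l := (n.-1 %% Mprod m N).+1%N.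
have nE : n = (a * Mprod m N + l)%N.
  by rewrite /l addnS -divn_eq prednK// (leq_trans _ Mn).
have aN : (a < m N)%N.
  rewrite ltn_divLR// mulnC -MprodS prednK//; exact: leq_trans Mn.
have a0 : (0 < a)%N.
  by rewrite divn_gt0// -ltnS prednK// (leq_trans _ Mn).
have lN : (l <= Mprod m N)%N by rewrite ltn_pmod.
(* Descent on the top digit: b M_N is read again as (b - 1) M_N + M_N, a full block, until M_N
   itself remains. This takes b steps of equal cost. *)
have steps b l' : (0 < b < m N)%N -> (l' <= Mprod m N)%N ->
    (cLnorm mu p (sigma (b * Mprod m N + l')) <=
     cLnorm mu p (sigma (Mprod m N)) + (b * (K * Mprod m N))%:R%:E * omega N)%E.
  have w0 := modulus_ge0 hm mu p N f.
  elim: b l' => // b IHb l' /andP[_ bN] l'N.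
  apply: (le_trans (@cLnorm_sigma_step N b.+1 l' _ l'N)); first by rewrite bN.
  rewrite (mulSn b (K * _)) addnC natrD EFinD ge0_muleDl ?lee_fin// addeA leeD2r//.
  case: b {l' l'N} IHb bN => [|b] IHb bN; first by rewrite !mul0n mul0e adde0 mul1n.
  rewrite mulSn addnC; apply: IHb => //; exact: ltnW.
rewrite nE (le_trans (steps _ _ _ lN)) ?a0//.
apply: leeD; first exact: IH.
rewrite muleA -EFinM -natrM lee_wpmul2r ?modulus_ge0// lee_fin ler_nat -!mulnA.
by rewrite leq_mul2r (leq_trans (ltnW aN) (hB N)) orbT.
Qed.

End FejerApproximation.

(** * Abel summation for the Nörlund means *)

Section NorlundMeans.
Variables (R : realType) (m : nat -> nat).
Hypothesis hm : forall k, (2 <= m k)%N.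
Local Notation G := (vilenkin m).
Local Notation normc := ComplexField.Normc.normc.
Variable mu : probability G R.
Hypothesis hmu : is_product_of_uniform mu.

(** Telescoping of q(n + 1 - k) S_k, with S_k the sum of the first k terms. The boundary value at k
    = n + 1 is q(0) S_(n+1), and at k = 0 it vanishes with S_0. *)
Lemma abel_sum (A : pzRingType) (q s : nat -> A) n :
  \sum_(k < n.+1) q (n - k)%N * s k =
  q 0%N * (\sum_(k < n.+1) s k) +
  \sum_(k < n.+1) (q (n.+1 - k)%N - q (n - k)%N) * \sum_(i < k) s i.
Proof.
pose S k := \sum_(i < k) s i.
pose u k := q (n.+1 - k)%N * S k.
have : \sum_(0 <= k < n.+1) (u k.+1 - u k) = q 0%N * S n.+1.
  by rewrite telescope_sumr// /u subnn /S big_ord0 mulr0 subr0.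
rewrite big_mkord => <-; rewrite -big_split/=; apply: eq_bigr => k _.
rewrite /u subSS /S big_ord_recr/= mulrDr mulrBl.
by rewrite addrA subrK addrAC subrr add0r.
Qed.

(** The weights q(n - k) for 1 <= k <= n add up to Q_n, so f(x) can be distributed over the S_k f.
    The index k = 0 is included, with value zero, to match the range of [abel_sum]. *)
Lemma norlund_sub (q : nat -> R) (f : G -> R[i]) n x : cintegrable mu f ->
  Qsum q n != 0 ->
  norlund mu q n f x - f x = ((Qsum q n)^-1)%:C%C *
    \sum_(k < n.+1) (q (n - k)%N)%:C%C * kernel_op mu f (dirichlet R k) x.
Proof.
move=> fi Q0; rewrite big_ord_recl kernel_op_dirichlet0 mulr0 add0r.
have QE : Qsum q n = \sum_(1 <= k < n.+1) q (n - k)%N.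
  rewrite /Qsum -(big_mkord xpredT q) big_nat_rev/= [RHS]big_add1/=.
  by apply: eq_bigr => k _; rewrite add0n.
have -> : f x = ((Qsum q n)^-1)%:C%C * \sum_(1 <= k < n.+1) (q (n - k)%N)%:C%C * f x.
  by rewrite -mulr_suml -rmorph_sum/= -QE mulrA -rmorphM/= mulVf// mul1r.
rewrite /norlund -mulrBr -sumrB big_add1/= big_mkord; congr (_ * _).
by apply: eq_bigr => k _; rewrite kernel_op_dirichlet// mulrBr.
Qed.

Lemma norlund_sub_abel (q : nat -> R) (f : G -> R[i]) n x : cintegrable mu f ->
  Qsum q n != 0 ->
  norlund mu q n f x - f x = ((Qsum q n)^-1)%:C%C *
    ((q 0%N)%:C%C * kernel_op mu f (dirichlet_sum R n.+1) x +
     \sum_(k < n.+1) (q (n.+1 - k)%N - q (n - k)%N)%:C%C *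
       kernel_op mu f (dirichlet_sum R k) x).
Proof.
move=> fi Q0; rewrite norlund_sub//; congr (_ * _).
rewrite (abel_sum (fun k => (q k)%:C%C) (fun k => kernel_op mu f (dirichlet R k) x)).
rewrite kernel_op_dirichlet_sum//; congr (_ + _); apply: eq_bigr => k _.
by rewrite kernel_op_dirichlet_sum// -rmorphB.
Qed.

Lemma cLnorm_sum (p : R) (I : Type) (s : seq I) (F : I -> G -> R[i]) : 1 <= p ->
  (forall i, cmeasurable (F i)) ->
  (cLnorm mu p (fun x => \sum_(i <- s) F i x)%R <= \sum_(i <- s) cLnorm mu p (F i))%E.
Proof.
move=> p1 mF.
have mnF i : measurable_fun setT (fun x => normc (F i x)) by exact: measurable_normc.
apply: le_trans (Lnorm_sum mu s p1 mnF); apply: le_Lnorm.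
- exact: lt_le_trans p1.
- exact/measurable_normc/cmeasurable_sum.
- exact: measurable_sum.
- by move=> x; rewrite normc_ge0 normc_sum.
Qed.

Lemma cLnormZ (p : R) (c : R) (f : G -> R[i]) : 1 <= p -> cmeasurable f ->
  cLnorm mu p (fun x => c%:C%C * f x) = (`|c|%:E * cLnorm mu p f)%E.
Proof.
move=> p1 mf; rewrite /cLnorm.
rewrite -[RHS](LnormZl mu _ (normr_ge0 c) (measurable_normc mf)); last first.
  exact: lt_le_trans p1.
by congr Lnorm; apply/funext => x; rewrite ComplexField.Normc.normcM normc_real.
Qed.

(** As q is non-increasing, the absolute differences telescope to q(0) - q(n + 1) <= q(0); with the
    boundary coefficient q(0) this makes 2 q(0). *)
Lemma cLnorm_norlund_sub (p : R) (q : nat -> R) (f : G -> R[i]) n (b : \bar R) :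
  1 <= p -> cintegrable mu f -> (forall k, 0 <= q k) -> 0 < q 0%N ->
  (forall k l, (k <= l)%N -> q l <= q k) -> (0 < n)%N -> (0 <= b)%E ->
  (forall k, (k <= n.+1)%N -> (cLnorm mu p (kernel_op mu f (dirichlet_sum R k)) <= b)%E) ->
  (cLnorm mu p (fun x => norlund mu q n f x - f x)%R <=
   ((Qsum q n)^-1 * (2 * q 0%N))%:E * b)%E.
Proof.
move=> p1 fi q0 q00 qn n0 b0 hb.
have Q0 : 0 < Qsum q n.
  case: n n0 {hb} => // n _; rewrite /Qsum big_ord_recl/=.
  by rewrite ltr_pwDl// sumr_ge0.
pose s k := kernel_op mu f (dirichlet_sum R k) : G -> R[i].
have ms k : cmeasurable (s k) by exact: cmeasurable_kernel_op_dirichlet_sum.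
have mcs (c : R) k : cmeasurable (fun x => c%:C%C * s k x).
  by apply: cmeasurableM => //; exact: cmeasurable_cst.
pose c k : R := q (n.+1 - k)%N - q (n - k)%N.
have mS : cmeasurable (fun x => \sum_(k < n.+1) (c k)%:C%C * s k x).
  by apply: cmeasurable_sum => k; exact: mcs.
have -> : (fun x => norlund mu q n f x - f x) = fun x => ((Qsum q n)^-1)%:C%C *
    ((q 0%N)%:C%C * s n.+1 x + \sum_(k < n.+1) (c k)%:C%C * s k x).
  by apply/funext => x; rewrite norlund_sub_abel// gt_eqF.
rewrite cLnormZ//; last exact: cmeasurableD.
rewrite ger0_norm ?invr_ge0 ?(ltW Q0)// EFinM -muleA lee_wpmul2l ?lee_fin ?invr_ge0 ?(ltW Q0)//.
apply: (le_trans (cLnormD mu p1 (mcs _ _) mS)).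
have cE k : (k <= n)%N -> `|c k| = q (n - k)%N - q (n - k).+1.
  move=> kn; rewrite /c subSn// ler0_norm ?opprB// subr_le0.
  by apply: qn; rewrite leqnSn.
apply: (@le_trans _ _ ((q 0%N)%:E * b + (\sum_(k < n.+1) `|c k|)%:E * b)%E).
  apply: leeD; first by rewrite cLnormZ// ger0_norm// lee_wpmul2l ?lee_fin ?hb.
  apply: (le_trans (cLnorm_sum _ p1 (fun k : 'I_n.+1 => mcs (c k) k))).
  rewrite -sumEFin ge0_sume_distrl//; apply: lee_sum => k _.
  by rewrite cLnormZ// lee_wpmul2l ?lee_fin ?hb// ltnW// ltnS ltnW.
rewrite -ge0_muleDl ?lee_fin ?sumr_ge0// -EFinD lee_wpmul2r// lee_fin.
rewrite mulr_natl mulr2n lerD2l.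
have -> : \sum_(k < n.+1) `|c k| = \sum_(0 <= k < n.+1) (q k - q k.+1).
  rewrite big_nat_rev/= add0n big_mkord; apply: eq_bigr => k _.
  by rewrite subSS cE// -ltnS.
have -> : \sum_(0 <= k < n.+1) (q k - q k.+1) = q 0%N - q n.+1.
  elim: (n.+1) => [|j IH]; first by rewrite big_geq// subrr.
  by rewrite big_nat_recr//= IH addrA subrK.
by rewrite gerBl.
Qed.

End NorlundMeans.

Theorem theorem3 (R : realType) (m : nat -> nat)
  (hm2 : forall k, (2 <= m k)%N)
  (hmb : exists B : nat, forall k, (m k <= B)%N)
  (mu : probability (vilenkin m) R) (hmu : is_product_of_uniform mu)
  (q : nat -> R)
  (hq_ge0 : forall k, 0 <= q k) (hq0 : 0 < q 0%N)
  (hQ : Qsum q n @[n --> \oo] --> +oo)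
  (hq_noninc : forall k l, (k <= l)%N -> q l <= q k)
  (hQO : (fun n : nat => (Qsum q n)^-1%R : R^o) =O_\oo
         (fun n : nat => n%:R^-1%R : R^o))
  (p : R) (hp : 1 <= p) :
  exists2 C : R, 0 < C &
    forall f : vilenkin m -> R[i], in_Lp mu p f ->
    forall N n : nat, (Mprod m N <= n < Mprod m N.+1)%N ->
      (cLnorm mu p (fun x => (norlund mu q n f x - f x)%R)
       <= C%:E * \sum_(j < N.+1)
            ((Mprod m j)%:R / (Mprod m N)%:R)%:E
              * modulus mu p ((Mprod m j)%:R^-1)%R f)%E.
Proof.
have [B hB] := hmb.
have Qn0 n : (0 < n)%N -> q 0%N <= Qsum q n.
  by case: n => // n _; rewrite /Qsum big_ord_recl/= lerDl sumr_ge0.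
have [C0 [C0_gt0 hC0]] : exists C0 : R, 0 < C0 /\
    forall n, (0 < n)%N -> (Qsum q n)^-1 <= C0 / n%:R.
  have /eqO_exP [k k0 [n0 _ hn0]] := hQO.
  (* The O-bound holds only from [n0] on. For 0 < n < n0 one has 1/Q_n <= 1/q_0 <= (n0 / q_0) / n,
     and the sum of the two constants serves all n. *)
  exists (k + n0%:R / q 0%N); split.
    by rewrite ltr_pwDl// divr_ge0// ltW.
  move=> n n_gt0; have n_gt0' : 0 < n%:R :> R by rewrite ltr0n.
  have Qpos : 0 < Qsum q n by rewrite (lt_le_trans hq0) ?Qn0.
  rewrite mulrDl; have [nn|nn] := leqP n0 n.
    have := hn0 n nn; rewrite /= !ger0_norm ?invr_ge0 ?(ltW Qpos)// => H.
    by rewrite (le_trans H)// lerDl !mulr_ge0// ?invr_ge0 ltW.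
  rewrite -[leLHS]add0r lerD//; first by rewrite mulr_ge0// ?invr_ge0 ltW.
  rewrite mulrAC (@le_trans _ _ (q 0%N)^-1)//.
    by rewrite lef_pV2 ?posrE// Qn0.
  rewrite ler_peMl ?invr_ge0 ?(ltW hq0)//.
  by rewrite ler_pdivlMr// mul1r ler_nat ltnW.
pose K := (B * (2 * B + 3 * B ^ 4))%N.
(* The summand 1 makes positivity immediate; the estimate itself uses K alone. *)
exists (C0 * (2 * q 0%N) * (K%:R + 1)).
  by rewrite !mulr_gt0// ltr_wpDl.
move=> f fLp N n /andP[Nn nN].
have fi := in_Lp_cintegrable hp fLp.
have M0 : (0 < Mprod m N)%N by exact: Mprod_gt0.
have n_gt0 : (0 < n)%N by exact: leq_trans Nn.
pose W := (\sum_(j < N.+1) (Mprod m j)%:R%:E * modulus mu p (Mprod m j)%:R^-1 f)%E.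
have W0 : (0 <= W)%E.
  by apply: sume_ge0 => j _; rewrite mule_ge0// modulus_ge0.
have -> : (\sum_(j < N.+1) ((Mprod m j)%:R / (Mprod m N)%:R)%:E *
    modulus mu p ((Mprod m j)%:R^-1)%R f)%E = (((Mprod m N)%:R^-1)%:E * W)%E.
  rewrite ge0_sume_distrr//; last by move=> j _; rewrite mule_ge0// modulus_ge0.
  by apply: eq_bigr => j _; rewrite mulrC EFinM muleA.
(* Abel summation involves F_k up to k = n + 1, and n < M_(N+1) gives exactly n + 1 <= M_(N+1).
   Hence [cLnorm_sigma] is used at level N + 1 and the sum runs over j <= N. *)
apply: (le_trans (cLnorm_norlund_sub hm2 hmu hp fi hq_ge0 hq0 hq_noninc n_gt0 _
  (b := K%:R%:E * W) (fun k kn => cLnorm_sigma hm2 hmu hB hp fi (leq_trans kn nN)))).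
  by rewrite mule_ge0.
rewrite !muleA -!EFinM lee_wpmul2r// lee_fin.
rewrite -!mulrA.
have Qle : (Qsum q n)^-1 <= C0 / (Mprod m N)%:R.
  rewrite (le_trans (hC0 n n_gt0))// ler_pM2l// lef_pV2 ?posrE ?ltr0n//.
  by rewrite ler_nat.
apply: (@le_trans _ _ (C0 / (Mprod m N)%:R * (2 * (q 0%N * K%:R)))).
  by rewrite ler_wpM2r// !mulr_ge0.
rewrite -mulrA ler_pM2l// mulrC -!mulrA; do 2 apply: ler_wpM2l => //.
by apply: ler_wpM2r => //; rewrite lerDl.
Qed.
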